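(* For all integers $i,j\ge 1$, the number of fighting fish with $i$ free left lower edges and $j$ free right lower edges is $$\frac{(2i+j-2)!\,(2j+i-2)!}{i!\,j!\,(2i-1)!\,(2j-1)!}=\frac{1}{ij}\binom{2i+j-2}{j-1}\binom{2j+i-2}{i-1}.$$
   Context: A cell is a unit square rotated by 45 degrees; its four edges are called its left upper, left lower, right upper and right lower edges. Cells are glued edge to edge; an edge of a cell is free if it is not glued to an edge of another cell. A fighting fish is a collection of cells glued along edges that can be obtained from a single initial cell (the head) by repeatedly applying one of the following operations: (i) if a cell $a$ has a free right upper edge, glue the left lower edge of a new cell to it; (ii) if a cell $a$ has a free right lower edge, glue the left upper edge of a new cell to it; (iii) if cells $a,b,c$ are such that the left lower edge of $b$ is glued to the right upper edge of $a$, the left upper edge of $c$ is glued to the right lower edge of $a$, and the right lower edge of $b$ and the right upper edge of $c$ are free, glue simultaneously the left upper edge of a new cell $d$ to the right lower edge of $b$ and the left lower edge of $d$ to the right upper edge of $c$. A fighting fish is the resulting glued object, independent of the order of construction (cells need not fit in the plane; their projections may overlap). *)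

(* Defs.v *)
From mathcomp Require Import all_boot.
Set Implicit Arguments. Unset Strict Implicit. Unset Printing Implicit Defensive.

(* A glued cell complex: cells are 0 .. ncells-1.
   up a = Some b  : the right upper edge of a is glued to the left lower edge of b.
   dn a = Some c  : the right lower edge of a is glued to the left upper edge of c.
   These are the only kinds of gluings produced by operations (i)-(iii). *)
Record complex := Complex { ncells : nat; up : nat -> option nat; dn : nat -> option nat }.

Definition upd (f : nat -> option nat) (a : nat) (v : nat) : nat -> option nat :=
  fun x => if x == a then Some v else f x.

Inductive fighting_fish : complex -> Prop :=
| ff_head : fighting_fish (Complex 1 (fun _ => None) (fun _ => None))
| ff_op1 n U D a : fighting_fish (Complex n U D) -> a < n -> U a = None ->
    fighting_fish (Complex n.+1 (upd U a n) D)
| ff_op2 n U D a : fighting_fish (Complex n U D) -> a < n -> D a = None ->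
    fighting_fish (Complex n.+1 U (upd D a n))
| ff_op3 n U D a b c : fighting_fish (Complex n U D) -> a < n ->
    U a = Some b -> D a = Some c -> D b = None -> U c = None ->
    fighting_fish (Complex n.+1 (upd U c n) (upd D b n)).

Definition iso (F G : complex) : Prop :=
  ncells F = ncells G /\
  exists f : nat -> nat,
    (forall x, x < ncells F -> f x < ncells G) /\
    (forall x y, x < ncells F -> y < ncells F -> f x = f y -> x = y) /\
    (forall x, x < ncells F -> up G (f x) = omap f (up F x)) /\
    (forall x, x < ncells F -> dn G (f x) = omap f (dn F x)).

Definition free_left_lower (F : complex) (x : nat) : bool :=
  ~~ has (fun y => up F y == Some x) (iota 0 (ncells F)).
Definition free_right_lower (F : complex) (x : nat) : bool := dn F x == None.

Definition n_free_left_lower (F : complex) : nat :=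
  count (free_left_lower F) (iota 0 (ncells F)).
Definition n_free_right_lower (F : complex) : nat :=
  count (free_right_lower F) (iota 0 (ncells F)).

Definition fish_ij (i j : nat) (F : complex) : Prop :=
  fighting_fish F /\ n_free_left_lower F = i /\ n_free_right_lower F = j.

Definition num_fish (i j N : nat) : Prop :=
  exists s : seq complex,
    size s = N /\
    (forall k, k < N -> fish_ij i j (nth (Complex 0 (fun _ => None) (fun _ => None)) s k)) /\
    (forall k l, k < N -> l < N ->
        iso (nth (Complex 0 (fun _ => None) (fun _ => None)) s k)
            (nth (Complex 0 (fun _ => None) (fun _ => None)) s l) -> k = l) /\
    (forall F, fish_ij i j F ->
        exists2 k, k < N & iso F (nth (Complex 0 (fun _ => None) (fun _ => None)) s k)).

(* Main.v *)
(* A strip of a fish is a maximal chain of cells glued along right upper edges; strips correspond to free left lower edges.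
   The right lower edges of a strip are free, or carry the cells of other strips hanging below it, so a fish is encoded by a binary
   tree ("skeleton"): the upper child of a cell is its right upper neighbour, the lower child is its right lower neighbour if that
   cell starts a strip, and a mere mark ("seam") if it has a left lower neighbour, in which case operation (iii) forces its identity.
   If x marks strips, y free right lower edges and u the length of the root strip, reading the root strip cell by cell gives
     (1 - u) F(u) = u (x + F(u)) (y (1 - u) + F(1) - F(u)).
   The quadratic method solves it: for x = a (1 - b)^2 and y = b (1 - a)^2, evaluating at u = 1 / (1 - a), a double root of the
   discriminant, forces F(1) = a b (1 - a - b). The announced numbers satisfy
     sum_(i, j) N(i, j) x^i y^j = a b (1 - a - b)
   because, for p, q > 1, the coefficient of a^p b^q on the left is a finite difference of order p + q - 2 of a polynomial in (i, j) of
   total degree p + q - 4. *)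
Require Import Defs.
From HB Require Import structures.
From mathcomp Require Import all_boot all_algebra ring zify.
From Stdlib Require Import FunctionalExtensionality.
Set Implicit Arguments. Unset Strict Implicit. Unset Printing Implicit Defensive.
Import GRing.Theory Num.Theory.

(** * Skeletons and their generating functions *)

Inductive skeleton := Bare | Seam | Cell of skeleton & skeleton.

Fixpoint eq_skeleton (S T : skeleton) : bool :=
  match S, T with
  | Bare, Bare | Seam, Seam => true
  | Cell u d, Cell u' d' => eq_skeleton u u' && eq_skeleton d d'
  | _, _ => false
  end.

Lemma eq_skeletonP : Equality.axiom eq_skeleton.
Proof.
elim=> [||u IHu d IHd] [||u' d'] /=; try by constructor.
by apply: (iffP andP) => [[/IHu -> /IHd ->]|[<- <-]] //; split; [apply/IHu|apply/IHd].
Qed.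

HB.instance Definition _ := hasDecEq.Build skeleton eq_skeletonP.

Definition is_cell (T : skeleton) : bool := if T is Cell _ _ then true else false.

Fixpoint strip_length (T : skeleton) : nat :=
  if T is Cell u _ then (strip_length u).+1 else 0.

(* [k] is the number of cells of the strip below onto which the start of the present strip can still be glued by seams. *)
Fixpoint valid (k : nat) (T : skeleton) : bool :=
  match T with
  | Bare => true
  | Seam => false
  | Cell u Bare => valid 0 u
  | Cell u Seam => (0 < k) && valid k.-1 u
  | Cell u d => valid 0 d && valid (strip_length d).-1 u
  end.

(** Each strip is counted at the leaf where it ends, so an empty strip counts 1; this is the term
    [x] in [x + F(u)]. *)
Fixpoint nstrips (T : skeleton) : nat :=
  if T is Cell u d then nstrips u + (if is_cell d then nstrips d else 0) else 1.

(** Only leaves in lower position count: a [Bare] upper child is a free right upper edge. *)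
Fixpoint nbare (T : skeleton) : nat :=
  if T is Cell u d then
    nbare u + match d with Bare => 1 | Seam => 0 | _ => nbare d end
  else 0.

Definition degree (T : skeleton) : nat := nstrips T + nbare T.

Lemma nstrips_gt0 T : 0 < nstrips T.
Proof. by elim: T => //= u IHu d _; rewrite addn_gt0 IHu. Qed.

Lemma degree_gt0 T : 0 < degree T.
Proof. by rewrite addn_gt0 nstrips_gt0. Qed.

Lemma degreeE u d : degree (Cell u d) =
  degree u + match d with Bare => 1 | Seam => 0 | _ => degree d end.
Proof. by rewrite /degree /=; case: d => [||v e] /=; lia. Qed.

Lemma validE k u v e : valid k (Cell u (Cell v e)) =
  valid 0 (Cell v e) && valid (strip_length v) u.
Proof. by []. Qed.

(** * Enumeration of the valid skeletons by degree *)

Definition seamless_skeletons (en : nat -> nat -> seq skeleton) (s : nat) :=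
  (if s == 1 then [:: Bare] else [::])
  ++ [seq Cell u Bare | u <- if 0 < s then en s.-1 0 else [::]]
  ++ [seq Cell u d | d <- [seq d <- flatten [seq en s1 0 | s1 <- iota 0 s] | is_cell d],
                     u <- en (s - degree d) (strip_length d).-1].

(* [fuel] bounds the recursion on the degree [s]; the inner recursion on [k] peels off the seams at the start of the root strip. *)
Fixpoint skeletons_rec (fuel s : nat) : nat -> seq skeleton :=
  if fuel is m.+1 then
    fix seams k := seamless_skeletons (skeletons_rec m) s ++
      (if k is k'.+1 then [seq Cell u Seam | u <- seams k'] else [::])
  else fun _ => [::].

Definition skeletons s k := skeletons_rec s s k.

Lemma skeletons_recS m s k : skeletons_rec m.+1 s k =
  seamless_skeletons (skeletons_rec m) s
  ++ (if k is k'.+1 then [seq Cell u Seam | u <- skeletons_rec m.+1 s k'] else [::]).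
Proof. by case: k. Qed.

Lemma eq_seamless_skeletons en en' s :
  (forall s' k, s' < s -> en s' k = en' s' k) ->
  seamless_skeletons en s = seamless_skeletons en' s.
Proof.
move=> eq_en; rewrite /seamless_skeletons; congr (_ ++ (_ ++ _)).
  by case: s eq_en => //= s eq_en; rewrite eq_en.
have ->: [seq en s1 0 | s1 <- iota 0 s] = [seq en' s1 0 | s1 <- iota 0 s].
  by apply/eq_in_map => s1; rewrite mem_iota => /andP[_ /eq_en].
congr flatten; apply/eq_in_map => d; rewrite mem_filter => /andP[_ /flattenP[l /mapP[s1 + ->]]].
rewrite mem_iota add0n => s1s _; rewrite eq_en //.
by rewrite ltn_subrL degree_gt0 (leq_ltn_trans _ s1s).
Qed.

Lemma skeletons_rec_fuel m s k : s <= m -> skeletons_rec m s k = skeletons s k.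
Proof.
move: {2}m (leqnn m) => M; elim: M m s k => [|M IH] m s k mM sm.
  by move: mM sm; rewrite leqn0 => /eqP ->; rewrite leqn0 => /eqP ->.
case: s sm => [|s] sm.
  by case: m mM sm => // m mM _; elim: k => [|k IHk]; rewrite skeletons_recS ?IHk.
case: m mM sm => // m mM sm; rewrite /skeletons.
elim: k => [|k IHk]; rewrite [LHS]skeletons_recS [RHS]skeletons_recS ?IHk; congr (_ ++ _);
  apply: eq_seamless_skeletons => s' k' s's; rewrite !IH //; lia.
Qed.

Lemma skeletonsE s k : 0 < s -> skeletons s k =
  seamless_skeletons skeletons s
  ++ (if k is k'.+1 then [seq Cell u Seam | u <- skeletons s k'] else [::]).
Proof.
case: s => // s _; rewrite /skeletons skeletons_recS; congr (_ ++ _).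
by apply: eq_seamless_skeletons => s' k' s's; rewrite skeletons_rec_fuel.
Qed.

Lemma skeletons0 k : skeletons 0 k = [::].
Proof. by []. Qed.

Lemma mem_seamless_skeletons en s T : 0 < s ->
  (forall s' k T, s' < s -> (T \in en s' k) = valid k T && (degree T == s')) ->
  (T \in seamless_skeletons en s) = valid 0 T && (degree T == s).
Proof.
move=> s0 IH; rewrite !mem_cat s0; case: T => [||u d].
- have ->: (Bare \in [seq Cell u Bare | u <- en s.-1 0]) = false by apply/mapP => -[].
  rewrite orbC; have -> /=: (Bare \in [seq Cell u d | d <-
     [seq d <- flatten [seq en s1 0 | s1 <- iota 0 s] | is_cell d],
     u <- en (s - degree d) (strip_length d).-1]) = false by apply/allpairsPdep => -[? [? []]].
  by rewrite /degree /= eq_sym; case: ifP.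
- apply/negP => /or3P[|/mapP[]|/allpairsPdep[? [? []]]] //.
  by case: ifP.
- have -> /=: (Cell u d \in if s == 1 then [:: Bare] else [::]) = false by case: ifP.
  rewrite degreeE; case: d => [||v e].
  + rewrite mem_map => [|? ? []//]; rewrite IH //; last by case: s s0 {IH}.
    rewrite orbC; case: allpairsPdep => [[d [u' [+ _ [_ dE]]]]|_].
      by rewrite mem_filter -dE.
    by rewrite addn1 /=; case: s s0 {IH} => // s.
  +  apply/negP => /orP[/mapP[? _ []]|/allpairsPdep[d [u' [+ _ [_ dE]]]]] //.
    by rewrite mem_filter -dE.
  + have ->: (Cell u (Cell v e) \in [seq Cell u0 Bare | u0 <- en s.-1 0]) = false by apply/mapP => -[].
    apply/allpairsPdep/idP => [[d [u' [hd hu [uE dE]]]]|/andP[/andP[vd vu] /eqP dE]].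
      move: hd hu; rewrite -uE -dE mem_filter => /andP[_ /flattenP[l /mapP[s1 + ->]]].
      rewrite mem_iota add0n => s1s; rewrite IH // => /andP[vd /eqP ds].
      rewrite -{}ds in s1s.
      rewrite IH; last by rewrite ltn_subrL degree_gt0.
      by case/andP=> vu /eqP h; rewrite vd vu h subnK ?eqxx // ltnW.
    exists (Cell v e), u; rewrite mem_filter /=; split=> //.
      apply/flattenP; exists (en (degree (Cell v e)) 0).
        by apply: map_f; rewrite mem_iota add0n /= -dE -[ltnLHS]add0n ltn_add2r degree_gt0.
      by rewrite IH ?vd ?eqxx // -dE -[ltnLHS]add0n ltn_add2r degree_gt0.
    by rewrite -{1}dE addnK IH ?vu ?eqxx // -dE -[ltnLHS]addn0 ltn_add2l degree_gt0.
Qed.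

(** A seam keeps the degree and uses up one unit of [k], hence an induction on [k] nested in the one
    on the degree. *)
Lemma mem_skeletons s k T : (T \in skeletons s k) = valid k T && (degree T == s).
Proof.
elim/ltn_ind: s k T => s IHs.
have [->|s0] := posnP s.
  by move=> k T; rewrite skeletons0 eqn0Ngt degree_gt0 andbF.
have IH' s' k T : s' < s -> (T \in skeletons s' k) = valid k T && (degree T == s').
  by move=> s's; apply: IHs.
elim=> [|k IHk] T; rewrite skeletonsE // mem_cat (mem_seamless_skeletons _ s0 IH') ?orbF //.
case: T => [||u d]; rewrite ?degreeE.
- by rewrite orbC; case: mapP => // -[? _ []].
- by apply/mapP => -[].
case: d => [||v e] /=.
- by rewrite orbC; case: mapP => // -[? _ []].
- by rewrite mem_map => [|? ? []//]; rewrite IHk addn0.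
- by rewrite orbC; case: mapP => // -[? _ []].
Qed.

Lemma uniq_seamless_skeletons s : (forall s' k, s' < s -> uniq (skeletons s' k)) ->
  uniq (seamless_skeletons skeletons s).
Proof.
move=> IH; rewrite !cat_uniq; apply/and3P; split; first by case: ifP.
  apply/hasPn => x; rewrite mem_cat; case: x => [||u d]; try by case: (s == 1).
  by move/orP=> [/mapP[]|/allpairsPdep[? [? []]]].
rewrite map_inj_uniq; last by move=> ? ? [].
apply/and3P; split.
- by case: s IH => //= s IH; apply: IH.
- by apply/hasPn => _ /allpairsPdep[d [u [+ _ ->]]]; rewrite mem_filter => /andP[cd _];
  apply/mapP => -[? _ [_ E]]; rewrite E in cd.
apply: allpairs_uniq_dep => [|d|[d u] [d' u'] _ _ /= [-> ->] //].
  apply: filter_uniq; elim: s IH => // s IHs IH.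
  rewrite -addn1 iotaD map_cat flatten_cat cat_uniq IHs /= ?cats0; last by move=> *; apply: IH; apply: ltnW.
  rewrite add0n IH // andbT; apply/hasPn => T; rewrite mem_skeletons => /andP[_ /eqP dT].
  apply/flattenP => -[_ /mapP[s1 + ->]]; rewrite mem_iota mem_skeletons dT => lt_s /andP[_ /eqP E].
  by rewrite E ltnn in lt_s.
by move=> /[!mem_filter] /andP[_ /flattenP[l /mapP[s1 + ->]]]; rewrite mem_iota => lt_s _;
  apply: IH; rewrite ltn_subrL degree_gt0; apply: leq_ltn_trans lt_s.
Qed.

Lemma uniq_skeletons s k : uniq (skeletons s k).
Proof.
elim/ltn_ind: s k => s IH; have [->|s0] := posnP s; first by move=> k; rewrite skeletons0.
have u0 : uniq (seamless_skeletons skeletons s).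
  by apply: uniq_seamless_skeletons => s' k s's; apply: IH.
elim=> [|k IHk]; rewrite skeletonsE // cat_uniq u0 //=.
rewrite map_inj_uniq ?IHk => [|? ? []//]; rewrite andbT.
apply/hasPn => _ /mapP[u _ ->]; rewrite mem_seamless_skeletons //= => s' k' T _.
exact: mem_skeletons.
Qed.

(** * The functional equation, degree by degree *)

Section GeneratingFunctions.
Local Open Scope ring_scope.
Variables (R : comNzRingType) (x y : R).

Definition weight (T : skeleton) : R := x ^+ nstrips T * y ^+ nbare T.

Definition strip_gf (s k : nat) : {poly R} :=
  \sum_(T <- skeletons s k) weight T *: 'X^(strip_length T).

Definition fish_gf (s : nat) : {poly R} :=
  \sum_(T <- skeletons s 0 | is_cell T) weight T *: 'X^(strip_length T).

Definition seamless_gf (s : nat) : {poly R} :=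
  (if s == 1 then x%:P else 0) + 'X * (y *: strip_gf s.-1 0 +
    \sum_(T <- [seq d <- flatten [seq skeletons s1 0 | s1 <- iota 0 s] | is_cell d])
       weight T *: strip_gf (s - degree T) (strip_length T).-1).

Lemma strip_gfS s k : (0 < s)%N ->
  strip_gf s k = seamless_gf s + (if k is k'.+1 then 'X * strip_gf s k' else 0).
Proof.
move=> s0; rewrite /strip_gf skeletonsE // big_cat; congr (_ + _); last first.
  case: k => [|k]; first by rewrite big_nil.
  rewrite big_map mulr_sumr; apply: eq_bigr => T _ /=.
  by rewrite /weight /= !addn0 exprS scalerAr.
rewrite !big_cat /=; congr (_ + _).
  case: (s == 1) => /=; rewrite ?big_nil // big_cons big_nil addr0.
  by rewrite /weight /= !expr1 mulr1 expr0 alg_polyC.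
rewrite mulrDr; congr (_ + _).
  rewrite s0 big_map scaler_sumr mulr_sumr; apply: eq_bigr => T _.
  by rewrite /weight /= addn0 addn1 !exprS scalerA -[RHS]scalerAr mulrCA.
rewrite big_allpairs_dep mulr_sumr big_filter [RHS]big_filter; apply: eq_bigr => d cd.
rewrite scaler_sumr mulr_sumr; apply: eq_bigr => u _ /=.
case: d cd => // v e _; rewrite scalerA -[RHS]scalerAr -exprS; congr (_ *: _).
rewrite /weight /= !exprD; ring.
Qed.

(** A skeleton valid at [k] is a run of [l <= k] seams followed by a skeleton valid at 0, and each
    seam only lengthens the strip by one. *)
Lemma strip_gf_geometric s k : strip_gf s k = strip_gf s 0 * \sum_(l < k.+1) 'X^l.
Proof.
have [->|s0] := posnP s; first by rewrite /strip_gf big_nil mul0r.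
rewrite (strip_gfS 0) // addr0.
elim: k => [|k IHk]; rewrite strip_gfS // ?IHk; first by rewrite big_ord1 expr0 mulr1 addr0.
rewrite [in RHS]big_ord_recl /= mulrDr expr0 mulr1; congr (_ + _).
rewrite mulrCA mulr_sumr; congr (_ * _); apply: eq_bigr => l _; by rewrite -exprS.
Qed.

Lemma strip_gf_fish s : strip_gf s 0 = (if s == 1 then x%:P else 0) + fish_gf s.
Proof.
rewrite /strip_gf /fish_gf (bigID is_cell) /= addrC; congr (_ + _).
have [->|s1] := eqVneq s 1.
  by rewrite /= big_cons big_nil /= addr0 /weight /= !expr1 mulr1 expr0 alg_polyC.
rewrite big1_seq // => T /andP[cT]; rewrite mem_skeletons => /andP[vT /eqP dT].
by case: T cT vT dT => // _ _ /esym dT; rewrite dT in s1.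
Qed.

Lemma horner1_fish_gf s : (fish_gf s).[1] = \sum_(T <- skeletons s 0 | is_cell T) weight T.
Proof.
by rewrite /fish_gf horner_sum; apply: eq_bigr => T _; rewrite hornerZ hornerXn expr1n mulr1.
Qed.

(** The factor ['X - 1] sums the geometric series: a lower child with root strip of length [L]
    contributes ['X^L - 1], and summing over these children gives [F(u) - F(1)], with ['X] as
    [u]. *)
Lemma fish_gf_eq s : ('X - 1) * fish_gf s =
  'X * (('X - 1) * (y *: strip_gf s.-1 0)
    + \sum_(s1 <- iota 0 s) (fish_gf s1 - (fish_gf s1).[1]%:P) * strip_gf (s - s1) 0).
Proof.
have [->|s0] := posnP s.
  by rewrite /fish_gf /strip_gf !big_nil scaler0 !mulr0 addr0 mulr0.
have -> : fish_gf s = seamless_gf s - (if s == 1 then x%:P else 0).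
  by rewrite -[seamless_gf s]addr0 -(strip_gfS 0 s0) strip_gf_fish; ring.
rewrite /seamless_gf addrAC subrr add0r mulrCA; congr (_ * _).
rewrite mulrDr; congr (_ + _).
rewrite big_filter big_flatten big_map mulr_sumr; apply: eq_big_seq => s1 _.
rewrite horner1_fish_gf raddf_sum /= -sumrB mulr_sumr mulr_suml.
rewrite [LHS]big_seq_cond [RHS]big_seq_cond.
apply: eq_bigr => T /andP[+ cT]; rewrite mem_skeletons => /andP[_ /eqP ->].
rewrite strip_gf_geometric -!scalerAr mulrCA -(subrX1 'X).
case: T cT => // u d _ /=.
by rewrite -mul_polyC -[in RHS]mul_polyC; ring.
Qed.

End GeneratingFunctions.

(** * The quadratic method *)

Section QuadraticMethod.
Local Open Scope ring_scope.

Lemma coprimepXn_horner0 (p : {poly rat}) n : p.[0] != 0 -> coprimep ('X^n) p.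
Proof. by move=> p0; rewrite coprimep_expl // coprimep_sym coprimepX. Qed.

Variables (s : rat) (K : nat) (F E : {poly {poly rat}}).
Hypothesis s0 : s != 0.
Let t : {poly rat} := 'X.
(** Restricting to a line [a = s b] replaces series in two variables by polynomials in [t] modulo
    [t ^+ K]; the outer polynomial variable is [u]. *)
Let a : {poly rat} := s%:P * t.
Let b : {poly rat} := t.
Let x := a * (1 - b) ^+ 2.
Let y := b * (1 - a) ^+ 2.
Let F1 := F.[1].
Hypothesis eqF : (1 - 'X) * F - 'X * (x%:P + F) * (y%:P * (1 - 'X) + F1%:P - F)
  = (t ^+ K)%:P * E.
Variable F' : {poly {poly rat}}.
Hypothesis t_dvd_F : F = t%:P * F'.
Hypothesis t2_dvd_F1 : t ^+ 2 %| F1.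

(* [u = 1 / (1 - a)], truncated, is the double root of the discriminant in [u] of the equation for [F]. *)
Let U := \sum_(i < K) a ^+ i.
Let P := F.[U].
Let Q := F^`().[U].
Let e := F1 - a * b * (1 - a - b).
Let r := U * (1 - a) - 1.
Let B := 1 - U + U * x - U * y + U ^+ 2 * y - U * F1.
(** The equation is quadratic in [F], with leading coefficient [u] and linear coefficient [B]; [G]
    is its derivative in the unknown, taken at [U], and [G'] is the derivative in [u] of
    [2 u F(u) + B(u)]. *)
Let G := 2 * U * P + B.
Let G' := 2 * P + 2 * U * Q + (x - 1 - y + 2 * U * y - F1).

Lemma eqF_at_root : (1 - U) * P - U * (x + P) * (y * (1 - U) + F1 - P) = t ^+ K * E.[U].
Proof. by have := congr1 (fun p : {poly _} => p.[U]) eqF; rewrite /P !hornerE. Qed.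

Lemma derivF_at_root : - P + (1 - U) * Q - ((x + P) * (y * (1 - U) + F1 - P)
   + U * Q * (y * (1 - U) + F1 - P) + U * (x + P) * (- y - Q)) = t ^+ K * E^`().[U].
Proof.
have := congr1 (fun p : {poly _} => p^`().[U]) eqF.
rewrite !derivE !hornerE => <-; rewrite /P /Q; ring.
Qed.

Lemma dvd_r : t ^+ K %| r.
Proof.
have -> : r = - (a ^+ K).
  rewrite /r (_ : U * (1 - a) - 1 = - ((a - 1) * U) - 1); last by ring.
  by rewrite /U -subrX1; ring.
by rewrite dvdpNr /a exprMn dvdp_mull.
Qed.

(** Completing the square: [G ^+ 2] is the discriminant plus [4 * U] times the equation, and at
    [u = 1 / (1 - a)] the discriminant is a multiple of the defect [e]. *)
Lemma dvd_square : t ^+ K %| G ^+ 2 - U ^+ 2 * e * (4 * a * (1 - b) + e).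
Proof.
(* The long factor of [r] is the quotient obtained by reducing modulo [U * (1 - a) = 1]. *)
have -> : G ^+ 2 - U ^+ 2 * e * (4 * a * (1 - b) + e) =
   4 * U * ((1 - U) * P - U * (x + P) * (y * (1 - U) + F1 - P)) +
   (- 1 + U * (1 + 2 * e + 2 * b - a + 2 * a * b - 4 * a * b ^+ 2)
    + U ^+ 2 * (- 2 * b - 2 * b * e - b ^+ 2 + 2 * a * b * e + 6 * a * b ^+ 2
                + 2 * a ^+ 2 * b - 5 * a ^+ 2 * b ^+ 2)
    + U ^+ 3 * b ^+ 2 * (1 - a) ^+ 3) * r.
  by rewrite /G /B /e /r /x /y; ring.
by rewrite eqF_at_root; apply: dvdp_add; apply: dvdp_mull; rewrite ?dvd_r // dvdp_mulr.
Qed.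

(** Differentiating the completed square in [u]: the derivative of the discriminant is a multiple of
    [e] as well, so the root is double when [e = 0]. *)
Lemma dvd_derive : t ^+ K %| 2 * G * G' - 2 * e *
  (- (1 - U + U * x - U * y + U ^+ 2 * y - U * (a * b * (1 - a - b)))
   - U * (x - 1 - y + 2 * U * y - a * b * (1 - a - b)) + U * e + 4 * U * x).
Proof.
set c := (X in _ * e * X).
have -> : 2 * G * G' - 2 * e * c =
   4 * ((1 - U) * P - U * (x + P) * (y * (1 - U) + F1 - P)) +
   4 * U * (- P + (1 - U) * Q - ((x + P) * (y * (1 - U) + F1 - P)
   + U * Q * (y * (1 - U) + F1 - P) + U * (x + P) * (- y - Q))) +
   (2 + 2 * b - 2 * a + 2 * a * b - 4 * a * b ^+ 2
    + U * (- 6 * b - 2 * b ^+ 2 + 16 * a * b ^+ 2 + 6 * a ^+ 2 * b - 14 * a ^+ 2 * b ^+ 2)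
    + 4 * U ^+ 2 * b ^+ 2 * (1 - a) ^+ 3) * r.
  by rewrite /G /G' /B /c /e /r /x /y; ring.
by rewrite eqF_at_root derivF_at_root; apply: dvdp_add; [apply: dvdp_add|];
  apply: dvdp_mull; rewrite ?dvd_r // dvdp_mulr.
Qed.

(** This makes [G'] invertible as a power series in [t]. *)
Lemma G'_at0 : (0 < K)%N -> G'.[0] = - 1.
Proof.
have [q ->] : exists q, G' = t * q - 1.
  have /dvdpP[f F1E] := t2_dvd_F1.
  exists (2 * F'.[U] + 2 * U * F'^`().[U] + s%:P * (1 - b) ^+ 2 - (1 - a) ^+ 2
    + 2 * U * (1 - a) ^+ 2 - f * t).
  have PE : P = t * F'.[U] by rewrite /P t_dvd_F hornerM hornerC.
  have QE : Q = t * F'^`().[U].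
    by rewrite /Q t_dvd_F derivM derivC mul0r add0r hornerM hornerC.
  by rewrite /G' F1E PE QE /x /y /a /b; ring.
by move=> _; rewrite hornerD hornerM hornerX mul0r add0r hornerN hornerC.
Qed.

Lemma U_at0 : (0 < K)%N -> U.[0] = 1.
Proof.
rewrite /U; case: K => // k _.
rewrite big_ord_recl expr0 hornerD hornerC horner_sum big1 ?addr0 // => i _.
by rewrite lift0 exprS hornerM /a hornerM hornerX mulr0 mul0r.
Qed.

Lemma dvd_defect2 : t ^+ 2 %| e.
Proof.
rewrite /e dvdp_sub // (_ : a * b = t ^+ 2 * s%:P); last by rewrite /a /b; ring.
by rewrite -mulrA dvdp_mulr.
Qed.

(** Bootstrapping on the order of [e]: if [t ^+ k] divides [e], then [dvd_derive] and the
    invertibility of [G'] make it divide [G], and [dvd_square] then yields one more factor [t] in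
    [e]. *)
Lemma dvd_defect : t ^+ K.-1 %| e.
Proof.
suff dvd_e k : (k <= K.-1)%N -> t ^+ k %| e by exact: dvd_e.
elim: k => [|k IHk] kK; first by rewrite expr0 dvd1p.
have [k1|k1] := leqP k.+1 2; first by apply: dvdp_trans dvd_defect2; apply: dvdp_exp2l.
have {}IHk := IHk (ltnW kK).
have K0 : (0 < K)%N by lia.
have kG : t ^+ k %| G.
  rewrite -(@Gauss_dvdpr _ _ (2 * G')); last first.
    by rewrite coprimepXn_horner0 // hornerM G'_at0 // !hornerE.
  have kK' : t ^+ k %| t ^+ K by rewrite dvdp_exp2l //; lia.
  have := dvdp_trans kK' dvd_derive; set c := (X in _ * e * X).
  rewrite dvdp_subl => [|]; first by rewrite mulrAC.
  by rewrite dvdp_mulr ?dvdp_mull.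
(* Here [2 <= k], so that [G ^+ 2], of order at least [2 * k], vanishes to order [k.+2]. *)
have k2K : t ^+ k.+2 %| t ^+ K by rewrite dvdp_exp2l //; lia.
have := dvdp_trans k2K dvd_square.
rewrite dvdp_subr; last first.
  by apply: (@dvdp_trans _ (t ^+ k ^+ 2)); rewrite ?dvdp_exp2r // -exprM dvdp_exp2l //; lia.
have [f eE] := dvdpP _ _ dvd_defect2.
(* As [t ^+ 2] divides [e], the last factor is [t] times a series with constant term [4 * s], which
   is invertible. *)
rewrite (_ : U ^+ 2 * e * (4 * a * (1 - b) + e) =
   t * (U ^+ 2 * (4 * s%:P * (1 - b) + f * t) * e)); last by rewrite [X in _ + X]eE /a; ring.
rewrite exprS dvdp_mul2l ?polyX_eq0 // Gauss_dvdpr //.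
apply: coprimepXn_horner0; rewrite /b !hornerE U_at0 //.
by rewrite /= expr1n mul1r mulf_neq0.
Qed.

End QuadraticMethod.

(** * Finite differences and the closed formula *)

Section FiniteDifferences.
Local Open Scope ring_scope.

(** Up to sign, the mixed finite difference at the origin, of order [m] in [i] and [n] in [j]. *)
Definition binom_diff (m n : nat) (g : nat -> nat -> rat) : rat :=
  \sum_(i < m.+1) \sum_(j < n.+1) (- 1) ^+ (i + j) * 'C(m, i)%:R * 'C(n, j)%:R * g i j.

Lemma eq_binom_diff m n g h : (forall i j, g i j = h i j) -> binom_diff m n g = binom_diff m n h.
Proof. by move=> gh; apply: eq_bigr => i _; apply: eq_bigr => j _; rewrite gh. Qed.

Lemma binom_diff_sym m n g : binom_diff m n g = binom_diff n m (fun i j => g j i).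
Proof.
rewrite /binom_diff exchange_big; apply: eq_bigr => j _; apply: eq_bigr => i _.
by rewrite addnC [_ * 'C(m, i)%:R * _]mulrAC.
Qed.

Lemma binom_diffD m n g h :
  binom_diff m n (fun i j => g i j + h i j) = binom_diff m n g + binom_diff m n h.
Proof.
rewrite -big_split; apply: eq_bigr => i _; rewrite -big_split; apply: eq_bigr => j _ /=.
exact: mulrDr.
Qed.

Lemma binom_diffZ m n c g : binom_diff m n (fun i j => c * g i j) = c * binom_diff m n g.
Proof.
rewrite mulr_sumr; apply: eq_bigr => i _; rewrite mulr_sumr; apply: eq_bigr => j _.
exact: mulrCA.
Qed.

(** The absorption [i * 'C(m, i) = m * 'C(m - 1, i - 1)] trades a factor [i] for one order of
    differencing and a shift. *)
Lemma binom_diffMl m n g :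
  binom_diff m n (fun i j => i%:R * g i j) = - m%:R * binom_diff m.-1 n (fun i j => g i.+1 j).
Proof.
case: m => [|m].
  rewrite oppr0 mul0r /binom_diff big_ord1 big1 // => j _; by rewrite mul0r mulr0.
rewrite /binom_diff big_ord_recl big1 => [|j _]; last by rewrite mul0r mulr0.
rewrite add0r mulr_sumr; apply: eq_bigr => i _; rewrite mulr_sumr; apply: eq_bigr => j _.
rewrite lift0 addSn exprS.
have : (m.+1 * 'C(m, i))%:R = (i.+1 * 'C(m.+1, i.+1))%:R :> rat by rewrite mul_bin_diag.
rewrite !natrM => h; transitivity (- (i.+1%:R * 'C(m.+1, i.+1)%:R) * ((-1) ^+ (i + j) * 'C(n, j)%:R * g i.+1 j)); first by ring.
rewrite -h; ring.
Qed.

Lemma binom_diffMr m n g :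
  binom_diff m n (fun i j => j%:R * g i j) = - n%:R * binom_diff m n.-1 (fun i j => g i j.+1).
Proof. by rewrite binom_diff_sym binom_diffMl [in RHS]binom_diff_sym. Qed.

Lemma sum_sign_bin n : \sum_(i < n.+1) (- 1) ^+ i * 'C(n, i)%:R = (n == 0)%:R :> rat.
Proof.
have := exprDn (1 : rat) (- 1) n; rewrite subrr expr0n => ->; apply: eq_bigr => i _.
by rewrite expr1n mul1r mulr_natr.
Qed.

(** A difference of order [m + n] kills polynomials of smaller total degree. Absorbing one affine
    factor at a time lowers degree and order together. *)
Lemma binom_diff_prod_linear (l : seq (rat * rat * rat)) m n : (size l < m + n)%N ->
  binom_diff m n (fun i j => \prod_(c <- l) (c.1.1 * i%:R + c.1.2 * j%:R + c.2)) = 0.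
Proof.
elim: {l}(size l) {-2}l (erefl (size l)) m n => [|d IHd] [|c l] //= => [_|[szl]] m n lt_mn.
  transitivity ((\sum_(i < m.+1) (- 1) ^+ i * 'C(m, i)%:R) *
                (\sum_(j < n.+1) (- 1) ^+ j * 'C(n, j)%:R) : rat); last first.
    by rewrite !sum_sign_bin -natrM; move: lt_mn; case: m n => [|m] [|n].
  rewrite mulr_suml; apply: eq_bigr => i _; rewrite mulr_sumr; apply: eq_bigr => j _.
  by rewrite big_nil exprD; ring.
rewrite szl in lt_mn; pose g i j : rat := \prod_(c <- l) (c.1.1 * i%:R + c.1.2 * j%:R + c.2).
rewrite (@eq_binom_diff _ _ _ (fun i j => (c.1.1 * (i%:R * g i j) + c.1.2 * (j%:R * g i j)) + c.2 * g i j)); last first.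
  by move=> i j; rewrite big_cons /g; ring.
rewrite !binom_diffD !binom_diffZ binom_diffMl binom_diffMr !mulNr.
(* Shifting [i] or [j] changes only the constant terms of the affine forms, so the induction
   hypothesis still applies. *)
have shift (u v : rat) m' n' : (d < m' + n')%N -> binom_diff m' n'
   (fun i j => \prod_(c <- l) (c.1.1 * i%:R + c.1.2 * j%:R + (c.2 + u * c.1.1 + v * c.1.2))) = 0.
  move=> lt_d; have := IHd [seq (c.1, c.2 + u * c.1.1 + v * c.1.2) | c <- l].
  rewrite size_map szl => /(_ erefl m' n' lt_d) <-.
  by apply: eq_binom_diff => i j; rewrite big_map.
have -> : binom_diff m n g = 0 by apply: IHd => //; rewrite szl ltnW.
have -> : m%:R * binom_diff m.-1 n (fun i j => g i.+1 j) = 0.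
  case: m lt_mn => [|m] lt_mn; first by rewrite mul0r.
  rewrite -[X in _ * X](@eq_binom_diff _ _
    (fun i j => \prod_(c <- l) (c.1.1 * i%:R + c.1.2 * j%:R + (c.2 + 1 * c.1.1 + 0 * c.1.2)))).
    by rewrite shift ?mulr0.
  by move=> i j; apply: eq_bigr => e _; rewrite -natr1; ring.
have -> : n%:R * binom_diff m n.-1 (fun i j => g i j.+1) = 0.
  case: n lt_mn => [|n] lt_mn; first by rewrite mul0r.
  rewrite -[X in _ * X](@eq_binom_diff _ _
    (fun i j => \prod_(c <- l) (c.1.1 * i%:R + c.1.2 * j%:R + (c.2 + 0 * c.1.1 + 1 * c.1.2)))).
    by rewrite shift ?mulr0 // -ltnS -addnS.
  by move=> i j; apply: eq_bigr => e _; rewrite -natr1; ring.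
ring.
Qed.

End FiniteDifferences.

(** * The closed formula and its generating function *)

Section ClosedForm.
Local Open Scope ring_scope.

(* The number of fish with [i.+1] left lower and [j.+1] right lower free edges. *)
Definition fish_number (i j : nat) : rat :=
  ((2 * i + j).+1`! * (2 * j + i).+1`!)%:R /
  (i.+1`! * j.+1`! * (2 * i).+1`! * (2 * j).+1`!)%:R.

Lemma ffact_prodr n m : (n ^_ m)%:R = \prod_(0 <= l < m) (n%:R - l%:R) :> rat.
Proof.
elim: m => [|m IHm]; first by rewrite big_geq.
rewrite big_nat_recr //= -IHm ffactnSr natrM; have [mn|nm] := leqP m n; first by rewrite natrB.
by rewrite ffact_small // !mul0r.
Qed.

(** Since [(2 * i + j).+1 - q.-1 = (2 * i).+2 - (q - j)], the binomial and the falling factorial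
    share a denominator; if [q - j] is too large, both vanish. *)
Lemma bin_mul_fact i j q : (j <= q)%N -> (0 < q)%N ->
  ('C((2 * i).+2, q - j) * (2 * i + j).+1`! * q`! =
   (2 * i).+2`! * j`! * 'C(q, j) * (2 * i + j).+1 ^_ q.-1)%N.
Proof.
move=> jq q0; have [le_q|lt_q] := leqP (q - j) (2 * i).+2; last first.
  by rewrite bin_small // ffact_small ?muln0 //; lia.
have := bin_fact le_q; have := bin_fact jq.
have le_q' : (q.-1 <= (2 * i + j).+1)%N by lia.
have := ffact_fact le_q'.
have -> : ((2 * i + j).+1 - q.-1 = (2 * i).+2 - (q - j))%N by lia.
move: (fact_gt0 (q - j)) (fact_gt0 ((2 * i).+2 - (q - j))).
move: ((2 * i).+2`!) ((2 * i + j).+1`!) ((_ - (q - j))`!) ((q - j)`!) => A D c e e0 c0 <- <- <-.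
ring.
Qed.

(** What multiplies ['C(p, i) * 'C(q, j)] is a polynomial in [(i, j)] of total degree [p + q - 2].
    The constant 4 comes from [(2 * i).+2 = 2 * i.+1] and its analogue for [j]. *)
Lemma fish_number_bin i j p q : (i <= p)%N -> (j <= q)%N -> (0 < p)%N -> (0 < q)%N ->
  fish_number i j * 'C((2 * i).+2, q - j)%:R * 'C((2 * j).+2, p - i)%:R =
  4 / (p`! * q`!)%:R * ('C(p, i)%:R * 'C(q, j)%:R
    * (((2 * i + j).+1 ^_ q.-1)%:R * ((2 * j + i).+1 ^_ p.-1)%:R)).
Proof.
move=> ip jq p0 q0.
have := congr1 (GRing.natmul (1 : rat)) (bin_mul_fact i jq q0).
have := congr1 (GRing.natmul (1 : rat)) (bin_mul_fact j ip p0).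
rewrite /fish_number !factS !natrM.
have fact_neq0 n : (n`!)%:R != 0 :> rat by rewrite pnatr_eq0 -lt0n fact_gt0.
move: (fact_neq0 p) (fact_neq0 q) (fact_neq0 i) (fact_neq0 j) (fact_neq0 (2 * i)%N) (fact_neq0 (2 * j)%N).
move=> p_neq0 q_neq0 i_neq0 j_neq0 i2_neq0 j2_neq0.
move: ((2 * i + j)`!) ((2 * j + i)`!) => D1 D2 h1 h2.
set X1 := (_ ^_ q.-1)%:R in h2 *; set X2 := (_ ^_ p.-1)%:R in h1 *.
have S_neq0 n : n.+1%:R != 0 :> rat by rewrite pnatr_eq0.
move: (S_neq0 i) (S_neq0 j) (S_neq0 (2 * i)%N) (S_neq0 (2 * j)%N) => i1 j1 i2 j2.
set den := (_ * _ * ((2 * j).+1%:R * _)).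
have den_neq0 : den != 0 by rewrite /den !mulf_neq0.
rewrite [LHS](_ : _ = (('C((2 * i).+2, q - j)%:R * ((2 * i + j).+1%:R * D1%:R) * q`!%:R) *
  ('C((2 * j).+2, p - i)%:R * ((2 * j + i).+1%:R * D2%:R) * p`!%:R)) / (p`!%:R * q`!%:R * den));
  last by field; rewrite den_neq0 p_neq0 q_neq0.
rewrite h1 h2 /den -!natr1 !natrM; rewrite -!natr1 !natrM in i1 j1 i2 j2 *.
by field; rewrite q_neq0 p_neq0 j2_neq0 j2 i2_neq0 i2 j_neq0 j1 i_neq0 i1.
Qed.

Lemma binom_diff_fish_number p q : (0 < p)%N -> (0 < q)%N ->
  \sum_(i < p.+1) \sum_(j < q.+1) (- 1) ^+ (i + j) *
    (fish_number i j * 'C((2 * i).+2, q - j)%:R * 'C((2 * j).+2, p - i)%:R) = 0.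
Proof.
(* The affine factors of both falling factorials: [p + q - 2] of them, fewer than the order
   [p + q]. *)
move=> p0 q0; pose l : seq (rat * rat * rat) :=
  [seq (2, 1, 1 - k%:R) | k <- iota 0 q.-1] ++ [seq (1, 2, 1 - k%:R) | k <- iota 0 p.-1].
have size_l : (size l < p + q)%N.
  by rewrite size_cat !size_map !size_iota; lia.
rewrite -[RHS](mulr0 (4 / (p`! * q`!)%:R)) -[X in _ = _ * X](binom_diff_prod_linear size_l).
rewrite mulr_sumr; apply: eq_bigr => i _; rewrite mulr_sumr; apply: eq_bigr => j _.
have [ip jq] : (i <= p)%N /\ (j <= q)%N by split; rewrite -ltnS.
rewrite fish_number_bin // !ffact_prodr big_cat !big_map /index_iota !subn0.
have -> : \prod_(k <- iota 0 q.-1) ((2 * i + j).+1%:R - k%:R) =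
   \prod_(k <- iota 0 q.-1) (2 * i%:R + 1 * j%:R + (1 - k%:R)) :> rat.
  by apply: eq_bigr => k _; rewrite -natr1 natrD natrM; ring.
have -> : \prod_(k <- iota 0 p.-1) ((2 * j + i).+1%:R - k%:R) =
   \prod_(k <- iota 0 p.-1) (1 * i%:R + 2 * j%:R + (1 - k%:R)) :> rat.
  by apply: eq_bigr => k _; rewrite -natr1 natrD natrM; ring.
rewrite /=; ring.
Qed.

Lemma fish_number0r i : fish_number i 0 = 1.
Proof.
rewrite /fish_number !muln0 add0n addn0 !muln1.
by rewrite mulnC divff // pnatr_eq0 muln_eq0 negb_or -!lt0n !fact_gt0.
Qed.

Lemma fish_numberC i j : fish_number i j = fish_number j i.
Proof.
rewrite /fish_number; congr (_%:R / _%:R); first by rewrite mulnC.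
ring.
Qed.

Lemma coef_1subZXn (s : rat) m k : ((1 - s%:P * 'X) ^+ m)`_k = (- s) ^+ k * 'C(m, k)%:R.
Proof.
elim: m k => [|m IHm] k.
  by rewrite expr0 coef1; case: k => [|k] //=; rewrite ?mulr1 // mulr0.
rewrite exprS mulrBl mul1r -mulrA coefB coefCM coefXM !IHm.
case: k => [|k] /=; first by rewrite mulr0 subr0 !bin0.
by rewrite binS natrD exprS; ring.
Qed.

Lemma sum_ord_cutoff n p (f : nat -> rat) : (p < n)%N ->
  \sum_(i < n) (if (p < i)%N then 0 else f i) = \sum_(i < p.+1) f i.
Proof.
move=> pn; rewrite (big_ord_widen n f pn) [RHS]big_mkcond; apply: eq_bigr => i _.
by rewrite ltnNge ltnS; case: (i <= p)%N.
Qed.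

(** Partial sums of the coefficients of [(1 - z)^2] are the coefficients of
    [(1 - z)^2 / (1 - z) = 1 - z]. *)
Lemma sum_sign_bin2 p : \sum_(i < p.+1) (- 1) ^+ (p - i) * 'C(2, p - i)%:R =
  (p == 0)%:R - (p == 1)%:R :> rat.
Proof.
rewrite (reindex_inj rev_ord_inj) /=.
rewrite (eq_bigr (fun i : 'I_p.+1 => (- 1) ^+ i * 'C(2, i)%:R)) => [|i _]; last first.
  by rewrite subSS subKn // -ltnS.
case: p => [|[|p]]; rewrite ?big_ord_recl ?big_ord0 //.
by rewrite big1 // => i _; rewrite !lift0 bin_small // mulr0.
Qed.

(* Coefficient of [a ^ p.+1 * b ^ q.+1] in the sum over [i, j < n] of
   [fish_number i j * (a * (1 - b) ^+ 2) ^+ i.+1 * (b * (1 - a) ^+ 2) ^+ j.+1]. *)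
Lemma sum_fish_number n p q : (p < n)%N -> (q < n)%N ->
  \sum_(i < n) \sum_(j < n) fish_number i j *
   ((if (q < j)%N then 0 else (- 1) ^+ (q - j) * 'C((2 * i).+2, q - j)%:R) *
    (if (p < i)%N then 0 else (- 1) ^+ (p - i) * 'C((2 * j).+2, p - i)%:R))
  = ((p == 0) && (q == 0))%:R - ((p == 1) && (q == 0))%:R - ((p == 0) && (q == 1))%:R.
Proof.
move=> pn qn; pose f i j := (- 1) ^+ (q - j) * (- 1) ^+ (p - i) *
  (fish_number i j * 'C((2 * i).+2, q - j)%:R * 'C((2 * j).+2, p - i)%:R).
transitivity (\sum_(i < p.+1) \sum_(j < q.+1) f i j).
  rewrite -(@sum_ord_cutoff n p (fun i => \sum_(j < q.+1) f i j)) //; apply: eq_bigr => i _.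
  have [_|_] := ltnP p i; first by rewrite big1 // => j _; rewrite !mulr0.
  rewrite -(@sum_ord_cutoff n q (f i)) //; apply: eq_bigr => j _.
  have [_|_] := ltnP q j; first by rewrite mul0r mulr0.
  by rewrite /f; ring.
(* For [p = 0] only [i = 0] remains, where all the numbers are 1; [q = 0] is symmetric, and finite
   differences settle the interior. *)
rewrite /f {f}; have [->|p0] := posnP p.
  transitivity (\sum_(j < q.+1) (- 1) ^+ (q - j) * 'C(2, q - j)%:R : rat).
    rewrite big_ord1; apply: eq_bigr => j _.
    by rewrite /= fish_numberC fish_number0r subn0 bin0 muln0; ring.
  by rewrite sum_sign_bin2 /= subr0.
have [->|q0] := posnP q.
  transitivity (\sum_(i < p.+1) (- 1) ^+ (p - i) * 'C(2, p - i)%:R : rat).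
    apply: eq_bigr => i _; rewrite big_ord1.
    by rewrite /= fish_number0r subn0 bin0 muln0; ring.
  by rewrite sum_sign_bin2 [(_ && (0%N == 1))]andbF !andbT subr0 eqn0Ngt p0.
transitivity ((- 1) ^+ (p + q) * (\sum_(i < p.+1) \sum_(j < q.+1) (- 1) ^+ (i + j) *
    (fish_number i j * 'C((2 * i).+2, q - j)%:R * 'C((2 * j).+2, p - i)%:R))).
  rewrite mulr_sumr; apply: eq_bigr => i _; rewrite mulr_sumr; apply: eq_bigr => j _.
  rewrite -exprD mulrA -exprD; congr (_ * _).
  have [ip jq] : (i <= p)%N /\ (j <= q)%N by split; rewrite -ltnS.
  rewrite -signr_odd -[RHS]signr_odd; congr (_ ^+ (nat_of_bool _)).
  by rewrite !oddD !oddB //; case: (odd p); case: (odd q); case: (odd i); case: (odd j).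
by rewrite binom_diff_fish_number // mulr0 /= andbF !subr0.
Qed.

(** On the line [a = s b], degree [k] collects the monomials [a^p b^q] with [p + q = k]. Terms with
    an index at least [n] start beyond degree [n], so truncating the sums is harmless. *)
Lemma coef_closed_form (s : rat) n k : (k <= n)%N ->
  let a : {poly rat} := s%:P * 'X in let b : {poly rat} := 'X in
  (\sum_(i < n) \sum_(j < n) fish_number i j *:
     ((a * (1 - b) ^+ 2) ^+ i.+1 * (b * (1 - a) ^+ 2) ^+ j.+1))`_k
  = (a * b * (1 - a - b))`_k.
Proof.
move=> kn a b.
have coefA c j m q : ('X^(j.+1) * (1 - c%:P * 'X) ^+ m : {poly rat})`_q.+1 =
    if (q < j)%N then 0 else (- c) ^+ (q - j) * 'C(m, q - j)%:R.
  by rewrite coefXnM ltnS subSS coef_1subZXn.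
have coefA0 c j m : ('X^(j.+1) * (1 - c%:P * 'X) ^+ m : {poly rat})`_0 = 0.
  by rewrite coefXnM.
have termE i j : (a * (1 - b) ^+ 2) ^+ i.+1 * (b * (1 - a) ^+ 2) ^+ j.+1 =
   ('X^(j.+1) * (1 - 1%:P * 'X) ^+ (2 * i).+2) * (s ^+ i.+1 *: ('X^(i.+1) * (1 - s%:P * 'X) ^+ (2 * j).+2)).
  have e2 l : ((2 * l).+2 = l.+1 + l.+1)%N by lia.
  by rewrite !exprMn !e2 !exprD /a /b mul1r -mul_polyC rmorphXn /=; ring.
(* [c p q] is the coefficient of [a^p b^q] in [a b (1 - a - b)], times the [s ^+ p] due to
   [a = s b]. *)
pose c (p q : nat) : rat := if (p == 0%N) || (q == 0%N) then 0 else
  s ^+ p * (((p == 1%N) && (q == 1%N))%:R - ((p == 2%N) && (q == 1%N))%:R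
            - ((p == 1%N) && (q == 2%N))%:R).
transitivity (\sum_(q < k.+1) c (k - q)%N q).
  rewrite coef_sum (eq_bigr (fun i : 'I_n => \sum_(q < k.+1) \sum_(j < n) fish_number i j *
     (('X^(j.+1) * (1 - 1%:P * 'X) ^+ (2 * i).+2 : {poly rat})`_q *
      (s ^+ i.+1 * ('X^(i.+1) * (1 - s%:P * 'X) ^+ (2 * j).+2)`_(k - q))))); last first.
    move=> i _; rewrite coef_sum exchange_big; apply: eq_bigr => j _.
    rewrite coefZ termE coefM mulr_sumr; apply: eq_bigr => q _.
    by rewrite coefZ.
  rewrite exchange_big; apply: eq_bigr => q _.
  case: q => [[|q] lt_q] /=.
    rewrite subn0 /c orbT big1 // => i _; rewrite big1 // => j _.
    by rewrite coefA0 mul0r mulr0.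
  rewrite /c; case kq: (k - q.+1)%N => [|p] /=.
    by rewrite big1 // => i _; rewrite big1 // => j _; rewrite coefA0 !mulr0.
  rewrite !eqSS -(@sum_fish_number n p q) ?mulr_sumr; try lia.
  apply: eq_bigr => i _; rewrite mulr_sumr; apply: eq_bigr => j _.
  rewrite !coefA; have [_|ip] := ltnP p i; first by rewrite !mulr0.
  case: ifP => _; first by rewrite !mul0r !mulr0.
  have -> : s ^+ p.+1 = s ^+ i.+1 * s ^+ (p - i) by rewrite -exprD addSn subnKC.
  by rewrite [(- s) ^+ _]exprNn; ring.
have -> : a * b * (1 - a - b) = s *: 'X^2 - (s ^+ 2 + s) *: 'X^3.
  rewrite -!mul_polyC rmorphD rmorphXn /=; rewrite /a /b; ring.
rewrite coefB !coefZ !coefXn.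
have [k4|] := leqP 4 k.
  rewrite !gtn_eqF ?mulr0 ?subr0 //; last exact: leq_trans k4.
  apply: big1 => q _; rewrite /c; case: ifP => // _.
  have -> : ((k - q == 1) && (q == 1 :> nat))%N = false by lia.
  have -> : ((k - q == 2) && (q == 1 :> nat))%N = false by lia.
  have -> : ((k - q == 1) && (q == 2 :> nat))%N = false by lia.
  by rewrite !subr0 mulr0.
case: k kn => [|[|[|[|//]]]] _ _; rewrite ?big_ord_recl big_ord0 /c /= ?lift0 /=; ring.
Qed.

End ClosedForm.

(** * Counting skeletons *)

Section Counting.
Local Open Scope ring_scope.

Lemma truncated_mul (R : comNzRingType) (t : R) K (A B : nat -> R) : exists E,
  (\sum_(d < K) t ^+ d * A d) * (\sum_(d < K) t ^+ d * B d) =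
  \sum_(d < K) t ^+ d * (\sum_(d1 < d.+1) A d1 * B (d - d1)%N) + t ^+ K * E.
Proof.
pose p := \poly_(d < K) A d; pose q := \poly_(d < K) B d.
have h (C : nat -> R) : \sum_(d < K) t ^+ d * C d = (\poly_(d < K) C d).[t].
  by rewrite horner_poly; apply: eq_bigr => d _; rewrite mulrC.
exists (drop_poly K (p * q)).[t].
rewrite !h -/p -/q -hornerM -{1}(poly_take_drop K (p * q)) hornerD hornerM hornerXn [_ * t ^+ K]mulrC.
congr (_ + _); rewrite /take_poly -(h (fun d => (p * q)`_d)); apply: eq_bigr => d _.
rewrite coefM; congr (_ * _); apply: eq_bigr => d1 _.
by rewrite !coef_poly !ifT //; have := ltn_ord d; have := ltn_ord d1; lia.
Qed.

Lemma strip_gf0 (R : comNzRingType) (x y : R) k : strip_gf x y 0 k = 0.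
Proof. by rewrite /strip_gf big_nil. Qed.

(** * The functional equation for the series truncated by degree *)

Section Scaling.
Variables (R : comNzRingType) (t x y : R).

Lemma weight_scale T : weight (t * x) (t * y) T = t ^+ degree T * weight x y T.
Proof. by rewrite /weight !exprMn exprD; ring. Qed.

Lemma fish_gf_scale d : fish_gf (t * x) (t * y) d = t%:P ^+ d * fish_gf x y d.
Proof.
rewrite /fish_gf mulr_sumr big_seq_cond [RHS]big_seq_cond; apply: eq_bigr => T.
rewrite mem_skeletons => /andP[/andP[_ /eqP dT] _].
by rewrite weight_scale dT -scalerA -rmorphXn /= mul_polyC.
Qed.

Lemma strip_gf_scale d : strip_gf (t * x) (t * y) d 0 = t%:P ^+ d * strip_gf x y d 0.
Proof.
rewrite /strip_gf mulr_sumr big_seq_cond [RHS]big_seq_cond; apply: eq_bigr => T.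
rewrite mem_skeletons => /andP[/andP[_ /eqP dT] _].
by rewrite weight_scale dT -scalerA -rmorphXn /= mul_polyC.
Qed.

Lemma fish_gf_small d : (d < 2)%N -> fish_gf x y d = 0.
Proof.
by case: d => [|[|//]] _; rewrite /fish_gf ?big_nil // big_cons big_nil.
Qed.

(** Scaling [x] and [y] by [t] makes [t] record the degree; summing the equations of degree below
    [K] turns convolutions into products up to a multiple of [t ^+ K]. *)
Lemma fish_gf_functional K : (1 < K)%N ->
  let F := \sum_(d < K) fish_gf (t * x) (t * y) d in
  exists E, (1 - 'X) * F - 'X * ((t * x)%:P + F) * ((t * y)%:P * (1 - 'X) + (F.[1])%:P - F)
    = (t ^+ K)%:P * E.
Proof.
move=> K1 F.
have HF : \sum_(d < K) strip_gf (t * x) (t * y) d 0 = (t * x)%:P + F.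
  rewrite (eq_bigr _ (fun (d : 'I_K) _ => strip_gf_fish (t * x) (t * y) d)) big_split /=; congr (_ + _).
  by rewrite (bigD1 (Ordinal K1)) //= big1 ?addr0 // => d; rewrite -val_eqE => /negPf /= ->.
pose g d := fish_gf x y d - (fish_gf x y d).[1]%:P.
have gF : \sum_(d < K) t%:P ^+ d * g d = F - F.[1]%:P.
  rewrite /F horner_sum raddf_sum -sumrB; apply: eq_bigr => d _ /=.
  by rewrite fish_gf_scale /g hornerM -rmorphXn hornerC mulrBr rmorphM.
have [E0 E0E] := truncated_mul t%:P K g (fun d => strip_gf x y d 0).
have HF' : \sum_(d < K) t%:P ^+ d * strip_gf x y d 0 = (t * x)%:P + F.
  by rewrite -HF; apply: eq_bigr => d _; rewrite strip_gf_scale.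
rewrite gF HF' in E0E.
have eqF : ('X - 1) * F = 'X * (('X - 1) * ((t * y) *: (\sum_(d < K) strip_gf (t * x) (t * y) d.-1 0)) +
   \sum_(d < K) t%:P ^+ d * (\sum_(d1 < d.+1) g d1 * strip_gf x y (d - d1) 0)).
  rewrite /F mulr_sumr (eq_bigr _ (fun (d : 'I_K) _ => fish_gf_eq (t * x) (t * y) d)).
  rewrite -mulr_sumr big_split /= -mulr_sumr -scaler_sumr; congr (_ * (_ + _)).
  apply: eq_bigr => d _; rewrite big_ord_recr /= subnn strip_gf0 mulr0 addr0.
  have -> : iota 0 d = index_iota 0 d by rewrite /index_iota subn0.
  rewrite big_mkord mulr_sumr; apply: eq_bigr => d1 _.
  rewrite strip_gf_scale fish_gf_scale hornerM -rmorphXn hornerC /g.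
  have -> : t%:P ^+ d = t%:P ^+ d1 * t%:P ^+ (d - d1) :> {poly R} by rewrite -exprD subnKC // ltnW.
  rewrite rmorphM !rmorphXn /=; ring.
(* Passing from [d] to [d.-1] loses only degree [K.-1]; with the [t] of [t * y], the loss is a
   multiple of [t ^+ K]. *)
have HS : \sum_(d < K) strip_gf (t * x) (t * y) d.-1 0 = (t * x)%:P + F - t%:P ^+ K.-1 * strip_gf x y K.-1 0.
  case: (K) K1 HF => // K' _ HF.
  rewrite -HF [in RHS]big_ord_recr [LHS]big_ord_recl /= strip_gf0 add0r strip_gf_scale addrK.
  by apply: eq_bigr.
exists ('X * (('X - 1) * (y%:P * strip_gf x y K.-1 0) + E0)).
rewrite rmorphXn /=.
have tK : t%:P ^+ K = t%:P * t%:P ^+ K.-1 :> {poly R} by rewrite -exprS prednK // ltnW.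
move: eqF; rewrite HS -mul_polyC; move/(canRL (addrK _)): (esym E0E) => -> => eqF.
rewrite (_ : (1 - 'X) * F = - (('X - 1) * F)); last by ring.
by rewrite eqF tK !rmorphM /=; ring.
Qed.

End Scaling.

Definition fish_skeletons (i j : nat) : seq skeleton :=
  [seq T <- skeletons (i + j) 0 | (nstrips T == i) && (nbare T == j)].

Lemma mem_fish_skeletons i j T :
  (T \in fish_skeletons i j) = [&& valid 0 T, nstrips T == i & nbare T == j].
Proof.
rewrite mem_filter mem_skeletons /degree.
by case: eqP => [->|_]; case: eqP => [->|_]; rewrite ?eqxx ?andbF ?andbT.
Qed.

(** Lower children lead from strip start to strip start, each valid at [k = 0], which forbids a
    seam; the descent ends at a [Bare]. *)
Lemma nbare_gt0 T : is_cell T -> valid 0 T -> (0 < nbare T)%N.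
Proof.
case: T => // u d _; elim: d u => [||u' IHu' d' IHd'] u //=; first by rewrite addn1.
by case/andP=> /IHd' h _; rewrite addn_gt0 orbC h.
Qed.

Lemma sum_fish_gf (R : comNzRingType) (x y : R) K :
  (\sum_(d < K) fish_gf x y d).[1] = \sum_(i < K) \sum_(j < K)
    (if (i.+1 + j.+1 < K)%N then (size (fish_skeletons i.+1 j.+1))%:R * (x ^+ i.+1 * y ^+ j.+1) else 0).
Proof.
pose w (i j : nat) T : R :=
  if (nstrips T == i.+1) && (nbare T == j.+1) then x ^+ i.+1 * y ^+ j.+1 else 0.
transitivity (\sum_(d < K) \sum_(i < K) \sum_(j < K) \sum_(T <- skeletons d 0 | is_cell T) w i j T).
  rewrite horner_sum; apply: eq_bigr => d _; rewrite horner1_fish_gf.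
  transitivity (\sum_(T <- skeletons d 0 | is_cell T) \sum_(i < K) \sum_(j < K) w i j T); last first.
    by rewrite exchange_big; apply: eq_bigr => i _; rewrite exchange_big.
  rewrite big_seq_cond [RHS]big_seq_cond; apply: eq_bigr => T.
  rewrite mem_skeletons => /andP[/andP[vT /eqP dT] cT].
  have := ltn_ord d; rewrite -{1}dT /degree => lt_K.
  have := nbare_gt0 cT vT; have := nstrips_gt0 T; rewrite /w /weight.
  case: (nstrips T) (nbare T) lt_K => [|i] [|j] // lt_K _ _.
  have iK : (i < K)%N by lia.
  have jK : (j < K)%N by lia.
  rewrite (bigD1 (Ordinal iK)) //= [X in _ + X]big1 ?addr0 => [|i' /negPf ne]; last first.
    by rewrite big1 // => j' _; rewrite eqSS eq_sym -val_eqE /= in ne *; rewrite ne.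
  rewrite (bigD1 (Ordinal jK)) //= !eqxx big1 ?addr0 // => j' /negPf ne.
  by rewrite eqSS eq_sym -val_eqE /= in ne *; rewrite ne.
rewrite exchange_big; apply: eq_bigr => i _; rewrite exchange_big; apply: eq_bigr => j _ /=.
have w0 d T : d != (i.+1 + j.+1)%N -> T \in skeletons d 0 -> w i j T = 0.
  rewrite mem_skeletons /w => ne /andP[_ /eqP dT].
  by case: ifP => // /andP[/eqP iT /eqP jT]; rewrite -dT /degree iT jT eqxx in ne.
case: ifP => [lt_K|le_K]; last first.
  apply: big1 => d _; apply: big1_seq => T /andP[_]; apply: w0.
  by apply: contraFneq le_K => <-.
rewrite (bigD1 (Ordinal lt_K)) //= [X in _ + X]big1 ?addr0 => [|d ne]; last first.
  by apply: big1_seq => T /andP[_]; apply: w0; rewrite -val_eqE in ne.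
rewrite -big_mkcondr /= big_const_seq iter_addr_0 mulr_natl size_filter; congr (_ *+ _).
apply: eq_in_count => T; rewrite mem_skeletons => _.
by case: T => [||u d] /=; rewrite ?andbF.
Qed.

Lemma fish_gf_div_t (R : comNzRingType) (t x y : R) K : exists F',
  \sum_(d < K) fish_gf (t * x) (t * y) d = (t ^+ 2)%:P * F'.
Proof.
exists (\sum_(d < K) t%:P ^+ d.-2 * fish_gf x y d); rewrite mulr_sumr.
apply: eq_bigr => d _; rewrite fish_gf_scale.
case: (nat_of_ord d) => [|[|n]]; try by rewrite fish_gf_small // !mulr0.
by rewrite mulrA rmorphXn -exprD.
Qed.

(** The quadratic method for the counts and [coef_closed_form] for the formula give the same series
    to this order; count terms cut off by degree have order at least [K]. *)
Lemma defect_fish_number (s : rat) (K : nat)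
  (a : {poly rat} := s%:P * 'X) (b : {poly rat} := 'X) : s != 0 -> (1 < K)%N ->
  'X ^+ K.-1 %| \sum_(i < K) \sum_(j < K)
    ((size (fish_skeletons i.+1 j.+1))%:R - fish_number i j) *:
     ((a * (1 - b) ^+ 2) ^+ i.+1 * (b * (1 - a) ^+ 2) ^+ j.+1).
Proof.
move=> s0 K1; set x := a * _; set y := b * _.
have xE : x = 'X * (s%:P * (1 - b) ^+ 2) by rewrite /x /a; ring.
have yE : y = 'X * (1 - a) ^+ 2 by [].
(* Both [x] and [y] are multiples of ['X], so the parameter of the line also serves as the degree
   variable. *)
have [E eqF] := fish_gf_functional 'X (s%:P * (1 - b) ^+ 2) ((1 - a) ^+ 2) K1.
have [F' F'E] := fish_gf_div_t 'X (s%:P * (1 - b) ^+ 2) ((1 - a) ^+ 2) K.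
rewrite -xE -yE in eqF F'E.
set F := \sum_(d < K) _ in eqF F'E.
have tF : F = 'X%:P * ('X%:P * F') by rewrite F'E rmorphXn /= expr2 mulrA.
have t2F1 : 'X ^+ 2 %| F.[1] by rewrite F'E hornerM hornerC dvdp_mulr.
have := dvd_defect s0 eqF tF t2F1.
rewrite /F sum_fish_gf => dvdF.
pose N i j : rat := (size (fish_skeletons i.+1 j.+1))%:R.
pose z i j := x ^+ i.+1 * y ^+ j.+1.
have split_sum : \sum_(i < K) \sum_(j < K) (N i j - fish_number i j) *: z i j
    + \sum_(i < K) \sum_(j < K) fish_number i j *: z i j =
  \sum_(i < K) \sum_(j < K) (if (i.+1 + j.+1 < K)%N then (size (fish_skeletons i.+1 j.+1))%:R * z i j else 0)
  + \sum_(i < K) \sum_(j < K) (if (i.+1 + j.+1 < K)%N then 0 else N i j *: z i j).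
  rewrite -!big_split; apply: eq_bigr => i _; rewrite -!big_split; apply: eq_bigr => j _ /=.
  rewrite -scalerDl subrK; case: ifP => _; rewrite ?addr0 ?add0r //.
  by rewrite /N scaler_nat mulr_natl.
have dvd_comb (d e S1 S2 S3 : {poly rat}) :
    d %| S1 - e -> d %| S2 -> d %| S3 - e -> d %| S1 + S2 - S3.
  move=> d1 d2 d3; rewrite (_ : S1 + S2 - S3 = (S1 - e) + S2 - (S3 - e)); last by ring.
  by apply: dvdp_sub => //; apply: dvdp_add.
rewrite (canRL (addrK _) split_sum); apply: (dvd_comb _ _ _ _ _ dvdF).
  have dvd_sum (f : 'I_K -> {poly rat}) : (forall i, 'X ^+ K.-1 %| f i) -> 'X ^+ K.-1 %| \sum_(i < K) f i.
    move=> dvd_f; apply: (big_ind (fun q => 'X ^+ K.-1 %| q)) => //.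
    by move=> q q'; apply: dvdp_add.
  apply/dvd_sum => i; apply/dvd_sum => j.
  case: ltnP => [_|le_K]; first exact: dvdp0.
  rewrite -mul_polyC dvdp_mull //.
  apply: (@dvdp_trans _ ('X ^+ (i.+1 + j.+1))); first by rewrite dvdp_exp2l //; lia.
  by rewrite exprD /z xE yE dvdp_mul // dvdp_exp2r // dvdp_mulr.
apply/dvdpP; exists (drop_poly K.-1 (\sum_(i < K) \sum_(j < K) fish_number i j *: z i j - a * b * (1 - a - b))).
rewrite -[LHS](poly_take_drop K.-1) [X in X + _](_ : _ = 0) ?add0r //.
apply/polyP => k; rewrite coef0 coef_take_poly; case: ltnP => // k_lt.
by rewrite coefB (@coef_closed_form s K k) ?subrr //; lia.
Qed.

(** Induction on [m = i + j]: once the smaller differences vanish, the coefficient of degree [m.+2]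
    on the line of slope [s] is [s * p.[s]], where [p] collects the differences with [i + j = m]. As
    [s] is any nonzero rational, [p = 0]. *)
Lemma size_fish_skeletons i j : (size (fish_skeletons i.+1 j.+1))%:R = fish_number i j.
Proof.
apply/eqP; rewrite -subr_eq0; apply/eqP.
pose D i j : rat := (size (fish_skeletons i.+1 j.+1))%:R - fish_number i j.
suff D0 m : forall i j, (i + j = m)%N -> D i j = 0 by exact: (D0 (i + j)%N).
elim/ltn_ind: m => m IH.
pose p : {poly rat} := \poly_(i < m.+1) D i (m - i)%N.
suff p0 : p = 0.
  move=> i' j' ij; have := congr1 (fun q : {poly rat} => q`_i') p0.
  by rewrite coef0 coef_poly ifT -?ij ?addKn //; lia.
have root_p s : s != 0 -> root p s.
  (* [K = m.+4] places degree [m.+2] just below the order [K.-1] to which the defect vanishes. *)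
  move=> s0; have := defect_fish_number s0 (isT : 1 < m.+4)%N.
  set a : {poly rat} := _ * 'X; set b : {poly rat} := 'X.
  move=> /dvdpP[q /(congr1 (fun q : {poly rat} => q`_m.+2))].
  rewrite coefMXn /= ltnSn => sum0.
  have zE i' j' : (a * (1 - b) ^+ 2) ^+ i'.+1 * (b * (1 - a) ^+ 2) ^+ j'.+1 =
    (s%:P ^+ i'.+1 * ((1 - b) ^+ 2) ^+ i'.+1 * ((1 - a) ^+ 2) ^+ j'.+1) * 'X^((i' + j').+2).
    by rewrite -addnS -addSn exprD /a /b !exprMn; ring.
  have coef_z i' j' : (D i' j' *: ((a * (1 - b) ^+ 2) ^+ i'.+1 * (b * (1 - a) ^+ 2) ^+ j'.+1))`_m.+2
     = if (i' + j' == m)%N then D i' j' * s ^+ i'.+1 else 0.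
    rewrite coefZ zE coefMXn !ltnS; case: ltngtP => [gt_m|lt_m|<-].
    - by rewrite mulr0.
    - by rewrite (IH _ lt_m) // mul0r.
    rewrite subnn -horner_coef0 /a /b !(hornerM, horner_exp, hornerD, hornerN, hornerX, hornerC).
    by rewrite mulr0 !subr0 !expr1n !mulr1.
  have : s * p.[s] = 0.
    rewrite -[RHS]sum0 coef_sum horner_poly mulr_sumr.
    rewrite -(@sum_ord_cutoff m.+4 m (fun i => s * (D i (m - i)%N * s ^+ i))) //; last by lia.
    apply: eq_bigr => i' _; rewrite coef_sum (eq_bigr _ (fun (j : 'I_m.+4) _ => coef_z i' j)).
    rewrite -big_mkcond /=; case: ltnP => [lt_m|le_m].
      by rewrite big_pred0 // => j'; lia.
    have lt4 : (m - i' < m.+4)%N by lia.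
    rewrite (big_pred1 (Ordinal lt4)) /= ?exprS; first by ring.
    by move=> j' /=; rewrite -val_eqE /=; lia.
  by move/eqP; rewrite mulf_eq0 (negPf s0).
apply: (@roots_geq_poly_eq0 _ p [seq n.+1%:R | n <- iota 0 m.+1]).
- by apply/allP => _ /mapP[n _ ->]; apply: root_p; rewrite pnatr_eq0.
- rewrite map_inj_uniq ?iota_uniq // => n n' /eqP.
  by rewrite eqr_nat eqSS => /eqP.
- by rewrite size_map size_iota size_poly.
Qed.

End Counting.

(** * Cell complexes and their skeletons *)

(** A static description of fighting fish whose cells are numbered in an order of construction;
    [wf_square] is the trace of operation (iii). *)
Record well_formed (F : complex) : Prop := WellFormed {
  wf_pos : 0 < ncells F;
  wf_up : forall x y, up F x = Some y -> x < y < ncells F;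
  wf_dn : forall x y, dn F x = Some y -> x < y < ncells F;
  wf_up_inj : forall x y z, up F x = Some z -> up F y = Some z -> x = y;
  wf_dn_inj : forall x y z, dn F x = Some z -> dn F y = Some z -> x = y;
  wf_parent : forall y, 0 < y < ncells F -> exists x, up F x = Some y \/ dn F x = Some y;
  wf_square : forall b c d, dn F b = Some d -> up F c = Some d ->
    exists2 a, up F a = Some b & dn F a = Some c }.

Lemma upd_eq f a v : upd f a v a = Some v.
Proof. by rewrite /upd eqxx. Qed.

Lemma upd_neq f a v x : x != a -> upd f a v x = f x.
Proof. by rewrite /upd => /negPf ->. Qed.

Lemma upd_Some f a v x y : upd f a v x = Some y -> (x = a /\ y = v) \/ f x = Some y.
Proof. by rewrite /upd; case: eqP => [-> [<-]|_ ->]; [left|right]. Qed.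

Lemma upd_None f a v x y : f a = None -> f x = Some y -> upd f a v x = Some y.
Proof. by move=> fa fx; rewrite upd_neq //; apply: contraPneq fx => ->; rewrite fa. Qed.

Lemma upd_lt n f a : a < n -> (forall x y, f x = Some y -> x < y < n) ->
  forall x y, upd f a n x = Some y -> x < y < n.+1.
Proof.
move=> an f_lt x y /upd_Some[[-> ->]|/f_lt/andP[-> yn]]; first by rewrite an ltnSn.
exact: ltnW.
Qed.

Lemma upd_inj n f a : (forall x y, f x = Some y -> x < y < n) ->
  (forall x y z, f x = Some z -> f y = Some z -> x = y) ->
  forall x y z, upd f a n x = Some z -> upd f a n y = Some z -> x = y.
Proof.
move=> f_lt f_inj x y z /upd_Some[[-> ->]|fx] /upd_Some[[-> zE]|fy] //.
- by have := f_lt _ _ fy; rewrite ltnn andbF.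
- by have := f_lt _ _ fx; rewrite zE ltnn andbF.
exact: f_inj fx fy.
Qed.

Lemma fish_well_formed F : fighting_fish F -> well_formed F.
Proof.
elim=> {F} [|n U D a _ wf an Ua|n U D a _ wf an Da|n U D a b c _ wf an Ua Da Db Uc].
- by split=> //= y; case: y.
- case: wf => /= pos Ult Dlt Uinj Dinj par sq; split=> //=.
  + exact: upd_lt.
  + by move=> x y /Dlt /andP[-> /ltnW].
  + exact: upd_inj.
  + move=> y /andP[y0]; rewrite ltnS leq_eqVlt => /orP[/eqP->|yn].
      by exists a; left; apply: upd_eq.
    have [|x [h|h]] := par y; first by rewrite y0.
      by exists x; left; apply: upd_None.
    by exists x; right.
  move=> b c d Db /upd_Some[[_ dE]|Uc]; first by have := Dlt _ _ Db; rewrite dE ltnn andbF.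
  by have [e Ue De] := sq _ _ _ Db Uc; exists e => //; apply: upd_None.
- case: wf => /= pos Ult Dlt Uinj Dinj par sq; split=> //=.
  + by move=> x y /Ult /andP[-> /ltnW].
  + exact: upd_lt.
  + exact: upd_inj.
  + move=> y /andP[y0]; rewrite ltnS leq_eqVlt => /orP[/eqP->|yn].
      by exists a; right; apply: upd_eq.
    have [|x [h|h]] := par y; first by rewrite y0.
      by exists x; left.
    by exists x; right; apply: upd_None.
  move=> b c d /upd_Some[[_ dE]|Db] Uc; first by have := Ult _ _ Uc; rewrite dE ltnn andbF.
  by have [e Ue De] := sq _ _ _ Db Uc; exists e => //; apply: upd_None.
case: wf => /= pos Ult Dlt Uinj Dinj par sq; split=> //=.
- by apply: upd_lt => //; have := Dlt _ _ Da; case/andP.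
- by apply: upd_lt => //; have := Ult _ _ Ua; case/andP.
- exact: upd_inj.
- exact: upd_inj.
- move=> y /andP[y0]; rewrite ltnS leq_eqVlt => /orP[/eqP->|yn].
    by exists c; left; apply: upd_eq.
  have [|x [h|h]] := par y; first by rewrite y0.
    by exists x; left; apply: upd_None.
  by exists x; right; apply: upd_None.
move=> b' c' d /upd_Some[[-> ->]|Db'] /upd_Some[[-> dE]|Uc'].
- by exists a; apply: upd_None.
- by have := Ult _ _ Uc'; rewrite ltnn andbF.
- by have := Dlt _ _ Db'; rewrite dE ltnn andbF.
by have [e Ue De] := sq _ _ _ Db' Uc'; exists e; apply: upd_None.
Qed.

Definition cut (n : nat) (f : nat -> option nat) : nat -> option nat :=
  fun x => if f x == Some n then None else f x.

Lemma cut_Some n f x y : cut n f x = Some y <-> f x = Some y /\ y != n.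
Proof.
rewrite /cut; case: eqP => [->|ne]; first by split=> // -[[->]]; rewrite eqxx.
split=> [fx|[] //]; split=> //; apply/eqP => yn; by rewrite fx yn in ne.
Qed.

Lemma upd_cut n f a : (forall x y z, f x = Some z -> f y = Some z -> x = y) ->
  f a = Some n -> upd (cut n f) a n = f.
Proof.
move=> f_inj fa; apply: functional_extensionality => x; rewrite /upd /cut.
have [->|xa] := eqVneq x a; first by rewrite fa.
by case: eqP => // fx; rewrite (f_inj _ _ _ fx fa) eqxx in xa.
Qed.

Lemma cut_id n f : (forall x, f x != Some n) -> cut n f = f.
Proof.
by move=> fn; apply: functional_extensionality => x; rewrite /cut (negPf (fn x)).
Qed.

Lemma well_formed_cut n U D : 0 < n ->
  well_formed (Complex n.+1 U D) -> well_formed (Complex n (cut n U) (cut n D)).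
Proof.
move=> n0 [/= pos Ult Dlt Uinj Dinj par sq]; split=> //=.
- move=> x y /cut_Some[/Ult /andP[-> yn] ne]; by rewrite ltn_neqAle ne.
- move=> x y /cut_Some[/Dlt /andP[-> yn] ne]; by rewrite ltn_neqAle ne.
- by move=> x y z /cut_Some[Ux _] /cut_Some[Uy _]; apply: Uinj Ux Uy.
- by move=> x y z /cut_Some[Dx _] /cut_Some[Dy _]; apply: Dinj Dx Dy.
- move=> y /andP[y0 yn]; have [|x [h|h]] := par y; first by rewrite y0 ltnW.
    by exists x; left; apply/cut_Some; rewrite neq_ltn yn.
  by exists x; right; apply/cut_Some; rewrite neq_ltn yn.
move=> b c d /cut_Some[Db _] /cut_Some[Uc _]; have [a Ua Da] := sq _ _ _ Db Uc.
have := Dlt _ _ Db; have := Ult _ _ Uc => lt_c lt_b.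
by exists a; apply/cut_Some; split=> //; lia.
Qed.

Lemma ex_parentP n (f : nat -> option nat) : (forall x y, f x = Some y -> x < y < n.+1) ->
  (exists a, f a = Some n) \/ (forall x, f x != Some n).
Proof.
move=> f_lt; have [/hasP[a _ /eqP fa]|/hasPn h] := boolP (has (fun x => f x == Some n) (iota 0 n)).
  by left; exists a.
right=> x; apply/negP => /eqP fx; have /h/negP : x \in iota 0 n.
  by rewrite mem_iota /=; have := f_lt _ _ fx; lia.
by rewrite fx eqxx.
Qed.

(** Gluings increase numbers, so the last cell has nothing on its right and can be removed; its one
    or two left neighbours tell which operation restores it. *)
Lemma well_formed_fish F : well_formed F -> fighting_fish F.
Proof.
case: F => n; elim: n => [|n IHn] U D wf; first by have := wf_pos wf.
have [n0|n0] := posnP n.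
  subst n; have -> : U = fun=> None.
    apply: functional_extensionality => x; case Ux: (U x) => [y|] //.
    by have := wf_up wf Ux => /=; lia.
  have -> : D = fun=> None.
    apply: functional_extensionality => x; case Dx: (D x) => [y|] //.
    by have := wf_dn wf Dx => /=; lia.
  exact: ff_head.
have := IHn _ _ (well_formed_cut n0 wf).
case: wf => /= pos Ult Dlt Uinj Dinj par sq ff.
have cut_None f a : f a = Some n -> cut n f a = None by rewrite /cut => ->; rewrite eqxx.
have cutS f x y : f x = Some y -> y < n -> cut n f x = Some y.
  by move=> fx yn; apply/cut_Some; rewrite neq_ltn yn.
have [[c Uc]|Un] := ex_parentP Ult; have [[b Db]|Dn] := ex_parentP Dlt.
- have [a Ua Da] := sq _ _ _ Db Uc.
  rewrite -(upd_cut Uinj Uc) -(upd_cut Dinj Db).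
  have := Ult _ _ Ua; have := Dlt _ _ Db; have := Ult _ _ Uc => c_lt b_lt a_lt.
  apply: (@ff_op3 _ _ _ a b c) => //; first lia.
  + by apply: cutS => //; lia.
  + by apply: cutS => //; lia.
  + exact: cut_None Db.
  exact: cut_None Uc.
- rewrite (cut_id Dn) in ff; rewrite -(upd_cut Uinj Uc).
  by apply: ff_op1 => //; [have := Ult _ _ Uc; case/andP|exact: cut_None Uc].
- rewrite (cut_id Un) in ff; rewrite -(upd_cut Dinj Db).
  by apply: ff_op2 => //; [have := Dlt _ _ Db; case/andP|exact: cut_None Db].
have [|x [h|h]] := par n; first by rewrite n0 ltnSn.
  by have := Un x; rewrite h eqxx.
by have := Dn x; rewrite h eqxx.
Qed.

(** * Existence, uniqueness and validity of the skeleton of a complex *)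

Section Skeleton.
Variable F : complex.
Hypothesis wf : well_formed F.

(* [below] records whether the edge leading to [o] is a right lower edge: there, a cell that also has a left lower neighbour is recorded as a seam. *)
Fixpoint has_skeleton (below : bool) (o : option nat) (T : skeleton) : Prop :=
  match T with
  | Bare => o = None
  | Seam => below /\ exists2 y, o = Some y & ~~ free_left_lower F y
  | Cell u d => exists y, [/\ o = Some y, below -> free_left_lower F y,
      has_skeleton false (up F y) u & has_skeleton true (dn F y) d]
  end.

Lemma up_glued x y : up F x = Some y -> ~~ free_left_lower F y.
Proof.
move=> Ux; rewrite negbK; apply/hasP; exists x; last exact/eqP.
by rewrite mem_iota /=; have := wf_up wf Ux; lia.
Qed.

Lemma glued_up y : ~~ free_left_lower F y -> exists x, up F x = Some y.
Proof. by rewrite negbK => /hasP[x _ /eqP Ux]; exists x. Qed.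

Lemma has_skeleton_below y T : free_left_lower F y ->
  has_skeleton false (Some y) T <-> has_skeleton true (Some y) T.
Proof.
move=> fy; case: T => [||u d] //=.
  by split=> [[]|[_ [_ [<-]]]] //; rewrite fy.
by split=> -[z [[<-] _ hu hd]]; exists y.
Qed.

Lemma ex_skeleton x : x < ncells F -> exists T, has_skeleton false (Some x) T.
Proof.
move: {2}(ncells F - x) (leqnn (ncells F - x)) => m.
elim: m x => [|m IHm] x le_m lt_x; first by lia.
have [u hu] : exists u, has_skeleton false (up F x) u.
  case Ux: (up F x) => [y|]; last by exists Bare.
  by have := wf_up wf Ux => /andP[xy yn]; apply: IHm => //; lia.
have [d hd] : exists d, has_skeleton true (dn F x) d.
  case Dx: (dn F x) => [y|]; last by exists Bare.
  have [fy|gy] := boolP (free_left_lower F y); last by exists Seam; split=> //; exists y.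
  have := wf_dn wf Dx => /andP[xy yn].
  have [|//|T /(has_skeleton_below _ fy) hT] := IHm y; first by lia.
  by exists T.
by exists (Cell u d), x.
Qed.

Lemma has_skeleton_inj below o S T :
  has_skeleton below o S -> has_skeleton below o T -> S = T.
Proof.
elim: S T below o => [||u IHu d IHd] [||u' d'] below o //=.
- by move=> -> [_ []].
- by move=> -> [? []].
- by move=> [_ [y -> _]].
- by move=> [b [y -> gy]] [z [[<-] /(_ b) fy]]; rewrite fy in gy.
- by move=> [y [->]].
- by move=> [z [-> fz _ _]] [b [y [<-] gy]]; rewrite fz in gy.
move=> [y [-> _ hu hd]] [z [[<-] _ hu' hd']].
by rewrite (IHu _ _ _ hu hu') (IHd _ _ _ hd hd').
Qed.

(** [V] is the part of the strip below that lies beyond the cell [c] under the predecessor [a]. By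
    [wf_square], the cell at a seam is [up F c], the first cell of [V], so each seam consumes one
    cell of [V]. *)
Lemma has_skeleton_valid T V o : has_skeleton false o T ->
  (forall a x, o = Some x -> up F a = Some x ->
    (dn F a = None /\ V = Bare) \/ exists2 c, dn F a = Some c & has_skeleton false (up F c) V) ->
  valid (strip_length V) T.
Proof.
elim: T V o => [||u IHu d IHd] V o; [by []|by case|].
move=> [x [-> _ hu hd]] ctx; case: d IHd hd => [||v e] IHd hd.
- apply: (IHu Bare _ hu) => a y Ux Ua; left; split=> //.
  by rewrite (wf_up_inj wf Ua Ux).
- case: hd => _ [z Dx /glued_up[c Uc]].
  have [a Ua Da] := wf_square wf Dx Uc.
  have [[]|[c' Dc']] := ctx _ _ erefl Ua; first by rewrite Da.
  move: Dc'; rewrite Da => -[<-] {c'}; rewrite Uc.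
  case: V ctx => [||V1 V2] _ //=; first by case.
  move=> [_ [[<-] _ hV1 _]]; apply: (IHu V1 _ hu) => a' y Ux Ua'; right; exists z => //.
  by rewrite (wf_up_inj wf Ua' Ux).
rewrite validE; case: hd => y [Dx /(_ isT) fy hv he]; apply/andP; split.
  apply: (IHd Bare (Some y)); first by exists y.
  by move=> a _ [<-] Ua; have := up_glued Ua; rewrite fy.
apply: (IHu v _ hu) => a z Ux Ua; right; exists y => //.
by rewrite (wf_up_inj wf Ua Ux).
Qed.

Lemma skeleton_valid T : has_skeleton false (Some 0) T -> valid 0 T.
Proof.
move=> hT; apply: (has_skeleton_valid (V := Bare) hT) => a _ [<-] Ua.
by have := wf_up wf Ua.
Qed.

End Skeleton.

(** * Addresses of cells in the skeleton *)

Fixpoint subskeleton (T : skeleton) (w : seq bool) : skeleton :=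
  if w is b :: w' then
    if subskeleton T w' is Cell u d then (if b then u else d) else Bare
  else T.

(** At a seam the square rule identifies the cell below [true :: w'] with the upper neighbour of the
    cell below [w']. *)
Fixpoint dn_address (T : skeleton) (w : seq bool) : option (seq bool) :=
  match subskeleton T (false :: w) with
  | Bare => None
  | Seam => if w is true :: w' then omap (cons true) (dn_address T w') else None
  | Cell _ _ => Some (false :: w)
  end.

Definition up_address (T : skeleton) (w : seq bool) : option (seq bool) :=
  if is_cell (subskeleton T (true :: w)) then Some (true :: w) else None.

Definition up_parent (F : complex) (y : nat) : option nat :=
  ohead [seq x <- iota 0 (ncells F) | up F x == Some y].

Definition dn_parent (F : complex) (y : nat) : option nat :=
  ohead [seq x <- iota 0 (ncells F) | dn F x == Some y].

Fixpoint address_rec (F : complex) (fuel y : nat) : seq bool :=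
  if fuel is k.+1 then
    if up_parent F y is Some x then true :: address_rec F k x
    else if dn_parent F y is Some x then false :: address_rec F k x
    else [::]
  else [::].

(* The path from the head to a cell, last step first, where a cell with a left lower neighbour is reached through that neighbour. *)
Definition address (F : complex) (y : nat) : seq bool := address_rec F y y.

Lemma oheadP (T : eqType) (s : seq T) x : (forall y, y \in s = (y == x)) -> ohead s = Some x.
Proof.
case: s => [|z s] h; first by have := h x; rewrite eqxx.
by have := h z; rewrite inE eqxx => /esym/eqP ->.
Qed.

Section Address.
Variable F : complex.
Hypothesis wf : well_formed F.

Lemma up_parentE x y : up F x = Some y -> up_parent F y = Some x.
Proof.
move=> Ux; apply: oheadP => z; rewrite mem_filter mem_iota add0n /=.
apply/andP/eqP => [[/eqP Uz _]|->]; first exact: (wf_up_inj wf Uz Ux).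
by split; [exact/eqP|have := wf_up wf Ux; lia].
Qed.

Lemma dn_parentE x y : dn F x = Some y -> dn_parent F y = Some x.
Proof.
move=> Dx; apply: oheadP => z; rewrite mem_filter mem_iota add0n /=.
apply/andP/eqP => [[/eqP Dz _]|->]; first exact: (wf_dn_inj wf Dz Dx).
by split; [exact/eqP|have := wf_dn wf Dx; lia].
Qed.

Lemma up_parent_None y : free_left_lower F y -> up_parent F y = None.
Proof.
rewrite /up_parent /free_left_lower => /hasPn fy.
rewrite (eq_in_filter (a2 := pred0)) ?filter_pred0 // => x /fy /negPf //.
Qed.

(** Induction along the spanning tree of addresses: the left lower neighbour is the parent when
    there is one, the left upper neighbour otherwise. *)
Lemma cell_ind (P : nat -> Prop) : P 0 ->
  (forall x y, x < y < ncells F -> up F x = Some y -> P x -> P y) ->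
  (forall x y, x < y < ncells F -> dn F x = Some y -> free_left_lower F y -> P x -> P y) ->
  forall y, y < ncells F -> P y.
Proof.
move=> P0 PU PD; elim/ltn_ind => y IH lt_y; have [->//|y0] := posnP y.
have [fy|/glued_up[x Ux]] := boolP (free_left_lower F y); last first.
  have lt_xy := wf_up wf Ux; apply: PU (lt_xy) Ux _; apply: IH; lia.
have [x [Ux|Dx]] := wf_parent wf (introT andP (conj y0 lt_y)).
  by have := up_glued wf Ux; rewrite fy.
have lt_xy := wf_dn wf Dx; apply: PD (lt_xy) Dx fy _; apply: IH; lia.
Qed.

Lemma head_free : free_left_lower F 0.
Proof.
by apply: contraT => /glued_up[x Ux]; have := wf_up wf Ux.
Qed.

Lemma address_rec0 m : address_rec F m 0 = [::].
Proof.
case: m => //= m; rewrite (up_parent_None head_free).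
rewrite /dn_parent (eq_filter (a2 := pred0)) ?filter_pred0 // => x /=.
by apply/eqP => Dx; have := wf_dn wf Dx.
Qed.

Lemma address_rec_fuel y : y < ncells F ->
  forall m, y <= m -> address_rec F m y = address F y.
Proof.
move: y; apply: cell_ind => [|x y xy Ux IHx|x y xy Dx fy IHx] m le_m.
- by rewrite /address !address_rec0.
- case: m y xy le_m Ux => [|m] [|y] // xy le_m Ux.
  by rewrite /address /= (up_parentE Ux) !IHx //; lia.
case: m y xy le_m Dx fy => [|m] [|y] // xy le_m Dx fy.
by rewrite /address /= (up_parent_None fy) (dn_parentE Dx) !IHx //; lia.
Qed.

Lemma address0 : address F 0 = [::].
Proof. by []. Qed.

Lemma address_up x y : up F x = Some y -> address F y = true :: address F x.
Proof.
move=> Ux; have := wf_up wf Ux; case: y Ux => // y Ux xy.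
by rewrite {1}/address /= (up_parentE Ux) address_rec_fuel //; lia.
Qed.

Lemma address_dn x y : dn F x = Some y -> free_left_lower F y ->
  address F y = false :: address F x.
Proof.
move=> Dx fy; have := wf_dn wf Dx; case: y Dx fy => // y Dx fy xy.
by rewrite {1}/address /= (up_parent_None fy) (dn_parentE Dx) address_rec_fuel //; lia.
Qed.

Lemma address_inj x y : x < ncells F -> y < ncells F -> address F x = address F y -> x = y.
Proof.
move: x y; have nz x y : x < y -> y < ncells F -> address F y <> [::].
  move: y; suff h y : y < ncells F -> 0 < y -> address F y <> [::].
    by move=> y xy yn; apply: h => //; apply: leq_ltn_trans xy.
  move: y; apply: cell_ind => // [z y _ Uz _ _|z y _ Dz fy _ _].
    by rewrite (address_up Uz).
  by rewrite (address_dn Dz fy).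
have nz0 y : y < ncells F -> address F y = [::] -> y = 0.
  by move=> yn Ey; have [//|y0] := posnP y; have := nz 0 y y0 yn Ey.
move=> x y lt_x; move: x lt_x y; apply: cell_ind.
- by move=> y yn; rewrite address0 => /esym /(nz0 _ yn).
- move=> z x zx Uz IHz; apply: cell_ind => [|w y wy Uw _|w y wy Dw fy _].
  + by rewrite (address_up Uz).
  + rewrite (address_up Uz) (address_up Uw) => -[/IHz zw].
    by move: Uw; rewrite -zw; [rewrite Uz => -[]|lia].
  + by rewrite (address_up Uz) (address_dn Dw fy).
move=> z x zx Dz fx IHz; apply: cell_ind => [|w y wy Uw _|w y wy Dw fy _].
- by rewrite (address_dn Dz fx).
- by rewrite (address_up Uw) (address_dn Dz fx).
rewrite (address_dn Dz fx) (address_dn Dw fy) => -[/IHz zw].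
by move: Dw; rewrite -zw; [rewrite Dz => -[]|lia].
Qed.

Variable T : skeleton.
Hypothesis hT : has_skeleton F false (Some 0) T.

Lemma has_subskeleton x : x < ncells F ->
  has_skeleton F false (Some x) (subskeleton T (address F x)).
Proof.
move: x; apply: cell_ind => [//|x y xy Ux|x y xy Dx fy]; rewrite ?(address_up Ux) ?(address_dn Dx fy) /=;
  case: (subskeleton T _) => [//|[]//|u d [_ [[<-] _]]].
  by rewrite Ux.
by move=> _; rewrite Dx => hd; apply/has_skeleton_below.
Qed.

Lemma subskeleton_address x : x < ncells F -> exists u d,
  [/\ subskeleton T (address F x) = Cell u d, has_skeleton F false (up F x) u
    & has_skeleton F true (dn F x) d].
Proof.
move=> /has_subskeleton; case: (subskeleton T _) => [//|[]//|u d [_ [[<-] _ hu hd]]].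
by exists u, d.
Qed.

Lemma address_onto w : is_cell (subskeleton T w) -> exists2 x, x < ncells F & address F x = w.
Proof.
elim: w => [|b w IHw] cw; first by exists 0; rewrite // (wf_pos wf).
have /IHw[x lt_x xw] : is_cell (subskeleton T w) by move: cw => /=; case: (subskeleton T w).
have [u [d [Ew hu hd]]] := subskeleton_address lt_x.
move: cw; rewrite /= -xw Ew; case: b.
  case: u Ew hu => // u1 u2 _ [y [Ux _ _ _]] _; exists y; last exact: address_up.
  by have := wf_up wf Ux; case/andP.
case: d Ew hd => // u1 u2 _ [y [Dx fy _ _]] _; exists y; last exact: address_dn (fy isT).
by have := wf_dn wf Dx; case/andP.
Qed.

Lemma is_cell_address x : x < ncells F -> is_cell (subskeleton T (address F x)).
Proof. by move=> /subskeleton_address[u [d [-> _ _]]]. Qed.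

Lemma up_address_address x : x < ncells F ->
  up_address T (address F x) = omap (address F) (up F x).
Proof.
move=> lt_x; have [u [d [Ew hu _]]] := subskeleton_address lt_x.
rewrite /up_address /= Ew; case: u Ew hu => [||u1 u2] _ /=; first by move->.
  by case.
by move=> [y [Ux _ _ _]]; rewrite Ux /= (address_up Ux).
Qed.

Lemma dn_address_address x : x < ncells F ->
  dn_address T (address F x) = omap (address F) (dn F x).
Proof.
elim/ltn_ind: x => x IHx lt_x; have [u [d [Ew _ hd]]] := subskeleton_address lt_x.
case: d Ew hd => [||d1 d2] Ew hd.
- rewrite hd; case: (address F x) Ew => [|b w] /= -> //.
- have [_ [y Dx /glued_up[c Uc]]] := hd; have [a Ua Da] := wf_square wf Dx Uc.
  have := wf_up wf Ua => lt_ax.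
  rewrite Dx /= (address_up Uc); move: Ew; rewrite (address_up Ua) /= => ->.
  by rewrite IHx ?Da //; lia.
have [y [Dx /(_ isT) fy _ _]] := hd.
rewrite Dx /= (address_dn Dx fy); case: (address F x) Ew => [|b w] /= -> //.
Qed.

End Address.

(** * The fish with a given skeleton *)

(** Addresses list the last step first, so the step out of the root goes to the end. *)
Fixpoint cell_addresses (T : skeleton) : seq (seq bool) :=
  if T is Cell u d then
    [::] :: [seq rcons w true | w <- cell_addresses u] ++ [seq rcons w false | w <- cell_addresses d]
  else [::].

Lemma subskeleton_noncell T w : ~~ is_cell T -> w != [::] -> subskeleton T w = Bare.
Proof.
move=> cT; elim: w => // b [_ _|c w /(_ isT) IHw _]; first by case: T cT.
by rewrite -[LHS]/(if subskeleton T (c :: w) is Cell u d then if b then u else d else Bare) IHw.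
Qed.

Lemma subskeleton_rcons u d w b :
  subskeleton (Cell u d) (rcons w b) = subskeleton (if b then u else d) w.
Proof. by elim: w => //= c w ->. Qed.

Lemma mem_cell_addresses T w : (w \in cell_addresses T) = is_cell (subskeleton T w).
Proof.
elim: T w => [||u IHu d IHd] w /=; try by case: w => // b w; rewrite subskeleton_noncell.
case/lastP: w => // w b; rewrite inE mem_cat subskeleton_rcons.
have -> /= : (rcons w b == [::]) = false by case: w.
have notin c A : c != b -> (rcons w b \in [seq rcons v c | v <- A]) = false.
  by move=> cb; apply/mapP => -[v _ /rcons_inj[_ bc]]; rewrite bc eqxx in cb.
have rcons_injl c : injective (rcons^~ c : seq bool -> _) by move=> v v' /rcons_inj[].
have inmap c A : (rcons w c \in [seq rcons v c | v <- A]) = (w \in A).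
  exact: mem_map (rcons_injl c) _ _.
by case: b notin => notin; rewrite inmap notin // ?orbF ?IHu ?IHd.
Qed.

Lemma uniq_cell_addresses T : uniq (cell_addresses T).
Proof.
elim: T => //= u IHu d IHd.
have rcons_injl c : injective (rcons^~ c : seq bool -> _) by move=> v v' /rcons_inj[].
rewrite cat_uniq !map_inj_uniq // IHu IHd /= andbT mem_cat; apply/andP; split.
  by apply/negP => /orP[] /mapP[[]].
by apply/hasPn => _ /mapP[w _ ->]; apply/mapP => -[v _ /rcons_inj[]].
Qed.

Definition sorted_addresses (T : skeleton) : seq (seq bool) :=
  sort (fun v w : seq bool => size v <= size w) (cell_addresses T).

Lemma mem_sorted_addresses T w : (w \in sorted_addresses T) = is_cell (subskeleton T w).
Proof. by rewrite mem_sort mem_cell_addresses. Qed.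

Lemma uniq_sorted_addresses T : uniq (sorted_addresses T).
Proof. by rewrite sort_uniq uniq_cell_addresses. Qed.

Lemma index_sorted_addresses T v w :
  v \in sorted_addresses T -> w \in sorted_addresses T -> size v < size w ->
  index v (sorted_addresses T) < index w (sorted_addresses T).
Proof.
move=> vT wT; rewrite ltnNge; apply: contraTT; rewrite -leqNgt negbK => le_wv.
have tr : transitive (fun v w : seq bool => size v <= size w).
  by move=> ? ? ?; apply: leq_trans.
have tot : total (fun v w : seq bool => size v <= size w) by move=> ? ?; apply: leq_total.
have := @sorted_leq_nth _ _ tr (fun w => leqnn (size w)) [::] _ (sort_sorted tot (cell_addresses T)).
move=> /(_ (index w (sorted_addresses T)) (index v (sorted_addresses T))).
rewrite !inE !index_mem !nth_index //; exact.
Qed.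

(* Cells are numbered by increasing length of their addresses: both kinds of gluings, seams included, lengthen the address by one. *)
Definition canonical_edge (T : skeleton) (e : skeleton -> seq bool -> option (seq bool)) (i : nat) :=
  if i < size (sorted_addresses T) then
    omap (fun w => index w (sorted_addresses T)) (e T (nth [::] (sorted_addresses T) i))
  else None.

Definition canonical (T : skeleton) : complex :=
  Complex (size (sorted_addresses T)) (canonical_edge T up_address) (canonical_edge T dn_address).

Lemma perm_addresses F T : well_formed F -> has_skeleton F false (Some 0) T ->
  perm_eq [seq address F x | x <- iota 0 (ncells F)] (cell_addresses T).
Proof.
move=> wf hT; apply/uniq_perm; last 1 first.
- move=> w; rewrite mem_cell_addresses; apply/mapP/idP => [[x + ->]|/(address_onto wf hT)[x lt_x <-]].
    by rewrite mem_iota => lt_x; apply: is_cell_address wf _ hT _ _.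
  by exists x; rewrite // mem_iota.
- rewrite map_inj_in_uniq ?iota_uniq // => x y; rewrite !mem_iota /= => lt_x lt_y.
  exact: address_inj wf _ _ _ _.
exact: uniq_cell_addresses.
Qed.

Lemma iso_canonical F T : well_formed F -> has_skeleton F false (Some 0) T -> iso F (canonical T).
Proof.
move=> wf hT; set A := sorted_addresses T.
have memA x : x < ncells F -> address F x \in A.
  by move=> lt_x; rewrite mem_sorted_addresses (is_cell_address wf hT).
have edgeE (e : skeleton -> seq bool -> option (seq bool)) f x : x < ncells F ->
    e T (address F x) = omap (address F) f ->
    canonical_edge T e (index (address F x) A) = omap (fun x => index (address F x) A) f.
  move=> /memA xA eE; rewrite /canonical_edge index_mem xA nth_index // eE.
  by case: f {eE}.
split; first by have /perm_size := perm_addresses wf hT; rewrite size_map size_iota /= size_sort.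
exists (fun x => index (address F x) A); split=> [x lt_x|]; first by rewrite index_mem memA.
split=> [x y lt_x lt_y Exy|].
  apply: (address_inj wf) => //.
  by rewrite -(nth_index [::] (memA x lt_x)) Exy nth_index // memA.
by split=> x lt_x; apply: edgeE => //; rewrite ?(up_address_address wf hT) ?(dn_address_address wf hT).
Qed.

(** * The canonical complex of a valid skeleton is a fish with that skeleton *)

Section Canonical.
Variable T : skeleton.
Hypothesis cT : is_cell T.
Hypothesis vT : valid 0 T.
Let A := sorted_addresses T.

(* [c] is the cell below the one at [w], and the strip of [c] is long enough for the seams of [u]. *)
Definition valid_below (w : seq bool) (u d : skeleton) : Prop :=
  (is_cell d -> valid 0 d) /\
  ((d = Bare /\ valid 0 u) \/
   exists c, [/\ dn_address T w = Some c, is_cell (subskeleton T c)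
      & valid (strip_length (subskeleton T (true :: c))) u]).

Lemma valid_below_step k w u d : subskeleton T w = Cell u d -> valid k (Cell u d) ->
  (d = Seam -> 0 < k -> exists c, [/\ dn_address T w = Some c, is_cell (subskeleton T c)
      & strip_length (subskeleton T (true :: c)) = k.-1]) ->
  valid_below w u d.
Proof.
case: d => [||v e] Ew.
- by move=> /= vu _; split=> //; left.
- move=> /= /andP[k0 vu] /(_ erefl k0)[c [Dc cc kE]]; split=> //; right.
  by exists c; rewrite kE.
rewrite validE => /andP[vd vu] _; split=> //; right; exists (false :: w).
rewrite /= Ew /=; split=> //.
by case: w Ew => [|b w] /= ->.
Qed.

(** Induction along the address: a lower child starts a strip with [k = 0], while an upper child is
    valid for the length of the strip beyond the cell below its parent. *)
Lemma subskeleton_valid_below w u d : subskeleton T w = Cell u d -> valid_below w u d.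
Proof.
elim: w u d => [|b w IHw] u d Ew.
  by apply: (valid_below_step (k := 0)) => //; rewrite -Ew.
have := Ew => /=; case Ew': (subskeleton T w) => [||u' d'] //.
have [vd' [[d'E vu']|[c [Dc cc vu']]]] := IHw _ _ Ew'.
  case: b Ew => Ew E; last by rewrite d'E in E.
  by apply: (valid_below_step (k := 0)) => //; rewrite -E.
case: b Ew => Ew E; last first.
  by apply: (valid_below_step (k := 0)) => //; rewrite -E vd' // E.
apply: valid_below_step; rewrite // -?E; first exact: vu'.
(* The seam points to the upper neighbour of the cell [c] below the parent; [0 < k] says that this
   neighbour exists. *)
move=> dS k0; exists (true :: c); split.
- by rewrite /= Ew' E dS Dc.
- by case: (subskeleton T (true :: c)) k0.
rewrite -[subskeleton T (true :: true :: c)]/(if subskeleton T (true :: c) is Cell x _ then x else Bare).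
by case: (subskeleton T (true :: c)) k0.
Qed.

Lemma mem_A w : (w \in A) = is_cell (subskeleton T w).
Proof. exact: mem_sorted_addresses. Qed.

Lemma dn_addressE w : dn_address T w =
  match subskeleton T (false :: w) with
  | Bare => None
  | Seam => if w is true :: w' then omap (cons true) (dn_address T w') else None
  | Cell _ _ => Some (false :: w)
  end.
Proof. by case: w. Qed.

Lemma dn_address_mem w v : w \in A -> dn_address T w = Some v -> v \in A.
Proof.
rewrite !mem_A; case Ew: (subskeleton T w) => [||u d] // _ Dw.
have [_ [[dE _]|[c [Dc cc _]]]] := subskeleton_valid_below Ew.
  by move: Dw; rewrite dn_addressE /= Ew dE.
by move: Dw; rewrite Dc => -[<-].
Qed.

Lemma dn_address_cons w v : dn_address T w = Some v ->
  v = false :: w \/ exists w' v', [/\ w = true :: w', v = true :: v' & dn_address T w' = Some v'].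
Proof.
rewrite dn_addressE; case: (subskeleton T (false :: w)) => [||x y] //; last by move=> [<-]; left.
case: w => [|[] w] //; case Dw: (dn_address T w) => [v'|] //= -[<-].
by right; exists w, v'.
Qed.

Lemma up_address_Some w v : up_address T w = Some v -> v = true :: w /\ v \in A.
Proof. by rewrite /up_address; case: ifP => // cw [<-]; rewrite mem_A. Qed.

Lemma size_dn_address w v : dn_address T w = Some v -> size v = (size w).+1.
Proof.
elim: w v => [|b w IHw] v /dn_address_cons[->//|[w' [v' [E -> Dw]]]] //.
by move: Dw; case: E => _ <- /IHw /= ->.
Qed.

Lemma dn_address_inj w w' v : dn_address T w = Some v -> dn_address T w' = Some v -> w = w'.
Proof.
elim: w w' v => [|b w IHw] w' v /dn_address_cons[->|[w1 [v1 [E1 -> D1]]]] /dn_address_cons[|[w2 [v2 [-> E D2]]]] //.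
- by case.
- by case.
- by move: D1 E D2; case: E1 => -> <- D1 [<-] D2; rewrite (IHw _ _ D1 D2).
Qed.

Lemma canonical_edgeP e x y :
  (forall w v, w \in A -> e T w = Some v -> v \in A) ->
  canonical_edge T e x = Some y ->
  exists w v, [/\ w \in A, v \in A, x = index w A, y = index v A & e T w = Some v].
Proof.
move=> e_mem; rewrite /canonical_edge; case: ltnP => // lt_x.
case Ew: (e T _) => [v|] //= [<-]; exists (nth [::] (sorted_addresses T) x), v.
have wA : nth [::] (sorted_addresses T) x \in A by apply: mem_nth.
by split=> //; [exact: e_mem wA Ew|rewrite index_uniq // uniq_sorted_addresses].
Qed.

Lemma canonical_edge_index e w v : w \in A -> e T w = v ->
  canonical_edge T e (index w A) = omap (fun w => index w A) v.
Proof. by move=> wA <-; rewrite /canonical_edge index_mem wA nth_index. Qed.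

Lemma index_A_inj v w : v \in A -> w \in A -> index v A = index w A -> v = w.
Proof. by move=> vA wA E; rewrite -(nth_index [::] vA) E nth_index. Qed.

Lemma up_canonicalP x y : up (canonical T) x = Some y ->
  exists w, [/\ w \in A, true :: w \in A, x = index w A & y = index (true :: w) A].
Proof.
move/canonical_edgeP => [w v _ /up_address_Some[_ ->]//|w [v [wA vA -> -> /up_address_Some[vE _]]]].
by exists w; rewrite -vE.
Qed.

Lemma dn_canonicalP x y : dn (canonical T) x = Some y ->
  exists w v, [/\ w \in A, v \in A, x = index w A, y = index v A & dn_address T w = Some v].
Proof. by move/canonical_edgeP; apply; exact: dn_address_mem. Qed.

Lemma up_canonical w : true :: w \in A ->
  up (canonical T) (index w A) = Some (index (true :: w) A).
Proof.
move=> twA; have wA : w \in A.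
  by move: twA; rewrite !mem_A /=; case: (subskeleton T w).
rewrite /= (canonical_edge_index (v := Some (true :: w)) wA) // /up_address.
by rewrite -mem_A twA.
Qed.

Lemma nil_A : [::] \in A. Proof. by rewrite mem_A. Qed.

Lemma index_nil : index [::] A = 0.
Proof.
apply/eqP; rewrite -leqn0 leqNgt; apply/negP => i0.
have lt0 : 0 < size A by case: (A) nil_A.
have A0 : nth [::] A 0 \in A by apply: mem_nth.
have i00 : index (nth [::] A 0) A = 0 by rewrite index_uniq // uniq_sorted_addresses.
case E0: (nth [::] A 0) A0 i00 => [|b w] A0 i00; first by rewrite i00 in i0.
by have := index_sorted_addresses nil_A A0 isT; rewrite -/A i00.
Qed.

Lemma canonical_well_formed : well_formed (canonical T).
Proof.
split.
- by rewrite /= -/A; case: (A) nil_A.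
- move=> x y /up_canonicalP[w [wA vA -> ->]].
  by rewrite index_mem vA andbT; apply: index_sorted_addresses.
- move=> x y /dn_canonicalP[w [v [wA vA -> -> Dw]]].
  by rewrite index_mem vA andbT; apply: index_sorted_addresses; rewrite // (size_dn_address Dw).
- move=> x y z /up_canonicalP[w [wA vA -> ->]] /up_canonicalP[w' [wA' vA' -> /(index_A_inj vA vA')[->]]] //.
- move=> x y z /dn_canonicalP[w [v [wA vA -> -> Dw]]] /dn_canonicalP[w' [v' [wA' vA' -> /(index_A_inj vA vA') E Dw']]].
  by rewrite -E in Dw'; rewrite (dn_address_inj Dw Dw').
- move=> y /andP[y0]; rewrite /= -/A => lt_y.
  have := mem_nth [::] lt_y; have := index_uniq [::] lt_y (uniq_sorted_addresses T).
  case: (nth [::] A y) => [|b w] yE; first by rewrite -yE index_nil in y0.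
  rewrite -{}yE => wA; have := wA; rewrite mem_A /=; case Ew: (subskeleton T w) => [||u d] // cb.
  have wA' : w \in A by rewrite mem_A Ew.
  exists (index w A); case: b wA cb => wA cb; [left|right]; first exact: up_canonical.
  rewrite (canonical_edge_index (v := Some (false :: w)) wA') //.
  by rewrite dn_addressE /= Ew; case: d Ew cb.
move=> b c d /dn_canonicalP[w [v [wA vA -> -> Dw]]] /up_canonicalP[w' [wA' vA' -> /(index_A_inj vA vA') E]].
(* A cell with a left lower neighbour has an address starting with [true], so the down edge into it
   is a seam, and the seam's recursion supplies the common neighbour [a]. *)
have [vE|[a [v' [wE vE Da]]]] := dn_address_cons Dw; first by rewrite vE in E.
move: E; rewrite vE => -[v'E]; rewrite v'E in vE Da; rewrite wE in wA *.
have aA : a \in A by move: wA; rewrite !mem_A /=; case: (subskeleton T a).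
exists (index a A); first exact: up_canonical.
by rewrite /= (canonical_edge_index (v := Some w') aA).
Qed.

Lemma canonical_subskeleton S w : subskeleton T w = S -> is_cell S ->
  has_skeleton (canonical T) false (Some (index w A)) S.
Proof.
elim: S w => [||u IHu d IHd] w Ew //= _.
have wA : w \in A by rewrite mem_A Ew.
exists (index w A); split=> //.
  rewrite (canonical_edge_index wA erefl) /up_address /= Ew.
  have [vd [[_ vu]|[c [_ _ vu]]]] := subskeleton_valid_below Ew;
  by case: u IHu Ew vu => [||u1 u2] // IHu Ew _; apply: (IHu (true :: w)); rewrite //= Ew.
rewrite (canonical_edge_index wA erefl).
have [vd [[dE vu]|[c [Dc cc vu]]]] := subskeleton_valid_below Ew.
  by rewrite dn_addressE /= Ew dE.
rewrite Dc; case: d IHd Ew vd => [||d1 d2] IHd Ew vd.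
- by move: Dc; rewrite dn_addressE /= Ew.
- split=> //; exists (index c A) => //.
  have [cE|[a [v' [wE cE Da]]]] := dn_address_cons Dc.
    by rewrite cE /= Ew in cc.
  rewrite cE in cc *; apply: (up_glued canonical_well_formed (x := index v' A)).
  by apply: up_canonical; rewrite mem_A.
have cE : c = false :: w by move: Dc; rewrite dn_addressE /= Ew => -[].
apply/has_skeleton_below; last by rewrite cE; apply: IHd; rewrite //= Ew.
apply: contraT => /(glued_up)[x /up_canonicalP[w' [_ w'A _ /index_A_inj]]].
by rewrite cE => /(_ _ w'A) E; have := E; rewrite mem_A /= Ew => /(_ isT).
Qed.

Lemma canonical_skeleton : has_skeleton (canonical T) false (Some 0) T.
Proof. by rewrite -index_nil; apply: canonical_subskeleton. Qed.

End Canonical.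

(** * Strips and free right lower edges counted on addresses *)

Definition starts_strip (w : seq bool) : bool := if w is false :: _ then true else false.

Lemma starts_strip_rcons w b :
  starts_strip (rcons w b) = (w == [::]) && ~~ b || starts_strip w.
Proof. by case: w => [|c w] /=; case: b. Qed.

Lemma count_root_or_starts_strip T :
  count (fun w => (w == [::]) || starts_strip w) (cell_addresses T) =
  if is_cell T then (count starts_strip (cell_addresses T)).+1 else 0.
Proof.
case: T => //= u d; rewrite add1n add0n; congr _.+1; apply: eq_in_count => w.
by rewrite mem_cat => /orP[] /mapP[w' _ ->]; rewrite -size_eq0 size_rcons.
Qed.

(** The successor accounts for the root strip, whose empty address is rejected by [starts_strip]. *)
Lemma count_starts_strip T : (count starts_strip (cell_addresses T)).+1 = nstrips T.
Proof.
elim: T => //= u IHu d IHd; rewrite add0n count_cat !count_map.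
rewrite (eq_count (a2 := starts_strip)) => [|w]; last by rewrite /= starts_strip_rcons andbF.
rewrite -addSn IHu; congr (_ + _); rewrite -IHd -count_root_or_starts_strip.
by apply: eq_count => w; rewrite /= starts_strip_rcons andbT.
Qed.

Lemma count_bare_address T :
  count (fun w => subskeleton T (false :: w) == Bare) (cell_addresses T) =
  if is_cell T then nbare T else 0.
Proof.
elim: T => //= u IHu d IHd; rewrite count_cat !count_map addnCA; congr (_ + _).
  rewrite -[RHS]/(nbare u).
  rewrite (eq_count (a2 := fun w => subskeleton u (false :: w) == Bare)) => [|w]; last first.
    by rewrite /= subskeleton_rcons.
  by rewrite IHu; case: (u).
rewrite (eq_count (a2 := fun w => subskeleton d (false :: w) == Bare)) => [|w]; last first.
  by rewrite /= subskeleton_rcons.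
by rewrite IHd; case: (d).
Qed.

Section Counts.
Variables (F : complex) (T : skeleton).
Hypothesis wf : well_formed F.
Hypothesis hT : has_skeleton F false (Some 0) T.

Lemma free_left_lower_address x : x < ncells F ->
  free_left_lower F x = (address F x == [::]) || starts_strip (address F x).
Proof.
move: x; apply: (cell_ind wf) => [|x y _ Ux _|x y _ Dx fy _].
- by rewrite head_free.
- by rewrite (negPf (up_glued wf Ux)) (address_up wf Ux).
by rewrite fy (address_dn wf Dx fy).
Qed.

Lemma n_free_left_lower_skeleton : n_free_left_lower F = nstrips T.
Proof.
rewrite -count_starts_strip /n_free_left_lower.
rewrite (eq_in_count (a2 := preim (address F) (fun w => (w == [::]) || starts_strip w))); last first.
  by move=> x; rewrite mem_iota => /free_left_lower_address.
rewrite -count_map (permP (perm_addresses wf hT)).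
rewrite count_root_or_starts_strip.
by have := hT; case: (T) => [||u d] //= [].
Qed.

Lemma n_free_right_lower_skeleton : n_free_right_lower F = nbare T.
Proof.
transitivity (if is_cell T then nbare T else 0); last first.
  by have := hT; case: (T) => [||u d] //= [].
rewrite -count_bare_address /n_free_right_lower -(permP (perm_addresses wf hT)) count_map.
apply: eq_in_count => x; rewrite mem_iota => lt_x.
have [u [d [/= -> _ hd]]] := subskeleton_address wf hT lt_x.
rewrite /free_right_lower; case: d hd => [||v e] /=; first by move=> ->.
  by case=> _ [y -> _].
by case=> y [-> _ _ _].
Qed.

End Counts.

(** * Skeletons classify fish up to isomorphism, and the final count *)

Lemma iso_skeleton F G T : well_formed F -> well_formed G -> iso F G ->
  has_skeleton F false (Some 0) T -> has_skeleton G false (Some 0) T.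
Proof.
move=> wfF wfG [eq_n [f [f_lt [f_inj [f_up f_dn]]]]].
have f_onto y : y < ncells G -> exists2 x, x < ncells F & y = f x.
  move=> lt_y; have : y \in [seq f x | x <- iota 0 (ncells F)].
    rewrite (uniq_min_size (s2 := iota 0 (ncells G)) _ _ _).2 ?mem_iota //.
    - by rewrite map_inj_in_uniq ?iota_uniq // => x z; rewrite !mem_iota /=; apply: f_inj.
    - by move=> _ /mapP[x + ->]; rewrite !mem_iota /=; apply: f_lt.
    by rewrite size_map !size_iota eq_n.
  by case/mapP=> x; rewrite mem_iota => lt_x ->; exists x.
have pF := wf_pos wfF.
(* Every cell of [G] other than 0 has a left neighbour, which would pull back to a left neighbour of
   the head of [F]. *)
have f0 : f 0 = 0.
  have [//|f0] := posnP (f 0).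
  have [|z Ez] := wf_parent wfG (y := f 0); first by rewrite f0 f_lt.
  have lt_z : z < ncells G.
    by case: Ez => [/(wf_up wfG)|/(wf_dn wfG)]; lia.
  have [x lt_x zE] := f_onto z lt_z; move: Ez; rewrite zE f_up // f_dn //.
  case=> [|]; [case E: (up F x) => [y|] //= [fy]|case E: (dn F x) => [y|] //= [fy]].
    by have := wf_up wfF E => /andP[xy lt_y]; rewrite (f_inj _ _ lt_y pF fy) in xy.
  by have := wf_dn wfF E => /andP[xy lt_y]; rewrite (f_inj _ _ lt_y pF fy) in xy.
have f_free y : y < ncells F -> free_left_lower G (f y) = free_left_lower F y.
  move=> lt_y; apply/idP/idP; apply: contraTT => /glued_up[x Ux].
    have /andP[xy _] := wf_up wfF Ux; have lt_x := ltn_trans xy lt_y.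
    by apply: (up_glued wfG (x := f x)); rewrite f_up // Ux.
  have lt_x : x < ncells G by have := wf_up wfG Ux; lia.
  have [z lt_z zE] := f_onto x lt_x; move: Ux; rewrite zE f_up //.
  case E: (up F z) => [w|] //= [fw]; apply: (up_glued wfF (x := z)).
  by rewrite E; congr Some; apply: f_inj => //; have := wf_up wfF E; case/andP.
have main S : forall below o, (forall x, o = Some x -> x < ncells F) ->
    has_skeleton F below o S -> has_skeleton G below (omap f o) S.
  elim: S => [||u IHu d IHd] below o lt_o /=; first by move=> ->.
    by case=> b [y oy gy]; split=> //; exists (f y); rewrite ?oy // f_free // lt_o.
  case=> x [ox fx hu hd]; have lt_x := lt_o _ ox; exists (f x); split; rewrite ?ox //.
  - by move=> /fx; rewrite f_free.
  - by rewrite f_up //; apply: IHu hu => y /(wf_up wfF); lia.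
  by rewrite f_dn //; apply: IHd hd => y /(wf_dn wfF); lia.
by move=> hT; rewrite -f0; apply: (main T false (Some 0)) => // x [<-].
Qed.

Lemma num_fish_skeletons i j : 0 < j -> num_fish i j (size (fish_skeletons i j)).
Proof.
move=> j0; set L := fish_skeletons i j.
exists [seq canonical T | T <- L]; rewrite size_map.
have nthE k : k < size L ->
    nth (Complex 0 (fun=> None) (fun=> None)) [seq canonical T | T <- L] k = canonical (nth Bare L k).
  by move=> lt_k; rewrite (nth_map Bare).
have L_cell T : T \in L -> [/\ is_cell T, valid 0 T, nstrips T = i & nbare T = j].
  rewrite mem_fish_skeletons => /and3P[vT /eqP iT /eqP jT]; split=> //.
  (* [0 < j] excludes [Bare], the only valid skeleton without cells. *)
  by case: T vT iT jT => // _ _ jE; rewrite -jE in j0.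
split=> //; split=> [k lt_k|].
  rewrite nthE //; have [cT vT iT jT] := L_cell _ (mem_nth Bare lt_k).
  have wfT := canonical_well_formed cT vT; have hT := canonical_skeleton cT vT.
  split; first exact: well_formed_fish.
  by rewrite (n_free_left_lower_skeleton wfT hT) (n_free_right_lower_skeleton wfT hT).
split=> [k l lt_k lt_l|F [/fish_well_formed wfF [iF jF]]].
  rewrite !nthE // => iso_kl.
  have [ck vk _ _] := L_cell _ (mem_nth Bare lt_k); have [cl vl _ _] := L_cell _ (mem_nth Bare lt_l).
  have wfk := canonical_well_formed ck vk; have wfl := canonical_well_formed cl vl.
  have := iso_skeleton wfk wfl iso_kl (canonical_skeleton ck vk).
  move/(has_skeleton_inj)/(_ (canonical_skeleton cl vl)) => /eqP.
  by rewrite nth_uniq ?filter_uniq ?uniq_skeletons // => /eqP.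
have [T hT] := ex_skeleton wfF (wf_pos wfF).
have TL : T \in L.
  rewrite mem_fish_skeletons (skeleton_valid wfF hT).
  by rewrite -(n_free_left_lower_skeleton wfF hT) -(n_free_right_lower_skeleton wfF hT) iF jF !eqxx.
exists (index T L); first by rewrite index_mem.
by rewrite nthE ?index_mem // nth_index //; apply: iso_canonical.
Qed.

Theorem theorem2 (i j : nat) (hi : 1 <= i) (hj : 1 <= j) :
  exists N : nat, num_fish i j N /\
    N * (i`! * j`! * (2 * i - 1)`! * (2 * j - 1)`!) = (2 * i + j - 2)`! * (2 * j + i - 2)`! /\
    i * j * N = 'C(2 * i + j - 2, j - 1) * 'C(2 * j + i - 2, i - 1).
Proof.
exists (size (fish_skeletons i j)); split; first exact: num_fish_skeletons.
case: i hi => // i _; case: j hj => // j _.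
have -> : 2 * i.+1 - 1 = (2 * i).+1 by lia.
have -> : 2 * j.+1 - 1 = (2 * j).+1 by lia.
have -> : 2 * i.+1 + j.+1 - 2 = (2 * i + j).+1 by lia.
have -> : 2 * j.+1 + i.+1 - 2 = (2 * j + i).+1 by lia.
rewrite !subn1 /=.
have countE : size (fish_skeletons i.+1 j.+1) * (i.+1`! * j.+1`! * (2 * i).+1`! * (2 * j).+1`!)
    = (2 * i + j).+1`! * (2 * j + i).+1`!.
  apply/eqP; rewrite -(eqr_nat rat) natrM size_fish_skeletons divfK //.
  by rewrite pnatr_eq0 -lt0n !muln_gt0 !fact_gt0.
split=> //; apply/eqP.
have le1 : j <= (2 * i + j).+1 by lia.
have le2 : i <= (2 * j + i).+1 by lia.
have := bin_fact le1; have := bin_fact le2.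
have -> : (2 * i + j).+1 - j = (2 * i).+1 by lia.
have -> : (2 * j + i).+1 - i = (2 * j).+1 by lia.
move=> bin2 bin1; move: countE; rewrite -bin1 -bin2 (factS i) (factS j) => countE.
have c_gt0 : 0 < i`! * j`! * (2 * i).+1`! * (2 * j).+1`! by rewrite !muln_gt0 !fact_gt0.
(* These factorials are the denominators of the two binomials; clearing them reduces the claim to
   the factorial form [countE]. *)
rewrite -(eqn_pmul2r c_gt0); apply/eqP.
transitivity (size (fish_skeletons i.+1 j.+1) *
  (i.+1 * i`! * (j.+1 * j`!) * (2 * i).+1`! * (2 * j).+1`!)); first by ring.
by rewrite countE; ring.
Qed.
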